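(* Let $M$ be a connected closed oriented smooth manifold of dimension $d\ge 2$, let $E$ be a trivial $\mathbb{C}^m$-bundle over $M$ with $m\ge 2$, and let $A$ be a pseudodifferential operator of order $s\in\mathbb{R}$ acting on the sections of $E$ whose principal symbol $A_{\mathrm{prin}}(x,\xi)$ is Hermitian and has simple eigenvalues for all $(x,\xi)\in T^*M\setminus\{0\}$. Let $h^{(j)}(x,\xi)$ be one of the $m$ eigenvalues of $A_{\mathrm{prin}}(x,\xi)$, and let $f^{(j)}:T^*M\setminus\{0\}\to\mathbb{C}\mathrm{P}^{m-1}$ be the smooth map sending $(x,\xi)$ to the eigenspace of $A_{\mathrm{prin}}(x,\xi)$ for the eigenvalue $h^{(j)}(x,\xi)$. For a fixed point $x\in M$, one can choose an eigenvector $v^{(j)}(x,\xi)$ of $A_{\mathrm{prin}}(x,\xi)$ corresponding to the eigenvalue $h^{(j)}(x,\xi)$ smoothly for all $\xi\in T^*_xM\setminus\{0\}$ if and only if (1) either $d\neq 3$, or (2) $d=3$ and the map $T^*_xM\setminus\{0\}\to\mathbb{C}\mathrm{P}^{m-1}$ obtained by restricting $f^{(j)}$ to the fibre at $x$ is homotopic to a constant map.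
   Context: $T^*M\setminus\{0\}$ denotes the cotangent bundle of $M$ with the zero section removed. The principal symbol $A_{\mathrm{prin}}(x,\xi)$ is a smooth $m\times m$ complex matrix-function on $T^*M\setminus\{0\}$, positively homogeneous of degree $s$ in $\xi$ (only the principal symbol matters; neither ellipticity nor self-adjointness of $A$ is assumed). Under the simplicity assumption the $m$ eigenvalues are smooth functions $h^{(j)}(x,\xi)$ on $T^*M\setminus\{0\}$, indexed by $j$ in a set $J\subset\mathbb{Z}$ with $m$ elements, and the eigenprojections $P^{(j)}(x,\xi)$ are smooth rank 1 matrix-functions, positively homogeneous of degree $0$ in $\xi$; $f^{(j)}(x,\xi)$ is the complex line through the origin in $\mathbb{C}^m$ which is the range of $P^{(j)}(x,\xi)$. Choosing an eigenvector smoothly for all $\xi\in T^*_xM\setminus\{0\}$ means finding a smooth map $v^{(j)}(x,\cdot):T^*_xM\setminus\{0\}\to\mathbb{C}^m\setminus\{0\}$ with $A_{\mathrm{prin}}(x,\xi)v^{(j)}(x,\xi)=h^{(j)}(x,\xi)v^{(j)}(x,\xi)$ for all $\xi\in T^*_xM\setminus\{0\}$. *)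

(* Defs.v *)
From HB Require Import structures.
From mathcomp Require Import all_boot all_order all_algebra.
From mathcomp Require Import complex.
From mathcomp Require Import all_classical all_reals all_analysis.
Import numFieldNormedType.Exports.

Set Implicit Arguments.
Unset Strict Implicit.
Unset Printing Implicit Defensive.

Import Order.TTheory GRing.Theory Num.Theory.
Local Open Scope classical_set_scope.
Local Open Scope ring_scope.
Local Open Scope complex_scope.

(* C^k and C^oo maps on an open set U; nothing is required outside U. *)
Fixpoint Ck_on (R : realType) (E W : normedModType R) (k : nat) (U : set E)
    (f : E -> W) : Prop :=
  match k with
  | 0 => forall x, U x -> {for x, continuous f}
  | k'.+1 => (forall x, U x -> differentiable f x) /\
             (forall e : E, Ck_on k' U ('D_e f))
  end.

Definition smooth_on (R : realType) (E W : normedModType R) (U : set E)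
  (f : E -> W) : Prop := forall k, Ck_on k U f.

(* R[i] is not declared as a normed module over R: a complex-valued function
   is smooth when its real and imaginary parts are. *)
Definition csmooth_on (R : realType) (E : normedModType R) (U : set E)
    (f : E -> R[i]) : Prop :=
  smooth_on U (fun x => complex.Re (f x)) /\
  smooth_on U (fun x => complex.Im (f x)).

(* A d-dimensional smooth manifold without boundary, given by an atlas. The
   functions [chart i] and [chart_inv i] are total, with junk values outside
   [dom i] and [chart i @` dom i] respectively. *)
Record smooth_manifold (R : realType) (d : nat) := SmoothManifold {
  carrier :> topologicalType ;
  chart_index : Type ;
  dom : chart_index -> set carrier ;
  chart : chart_index -> carrier -> 'rV[R]_d ;
  chart_inv : chart_index -> 'rV[R]_d -> carrier ;
  carrier_hausdorff : hausdorff_space carrier ;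
  carrier_second_countable : @second_countable carrier ;
  dom_open : forall i, open (dom i) ;
  dom_cover : forall x, exists i, dom i x ;
  image_open : forall i, open (chart i @` dom i) ;
  chartK : forall i x, dom i x -> chart_inv i (chart i x) = x ;
  chart_continuous : forall i x, dom i x -> {for x, continuous (chart i)} ;
  chart_inv_continuous : forall i y, (chart i @` dom i) y ->
    {for y, continuous (chart_inv i)} ;
  transition_smooth : forall i j,
    smooth_on (chart i @` (dom i `&` dom j)) (chart j \o chart_inv i)
}.

Arguments dom {R d s}.
Arguments chart {R d s}.
Arguments chart_inv {R d s}.

(* An oriented manifold is one given by an oriented atlas. *)
Definition oriented_atlas (R : realType) (d : nat) (M : smooth_manifold R d) :=
  forall (i j : chart_index M) (x : M), dom i x -> dom j x ->
    0 < \det (jacobian (chart j \o chart_inv i) (chart i x)).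

Definition closed_manifold (R : realType) (d : nat)
  (M : smooth_manifold R d) : Prop := compact [set: M].

Section CotangentBundle.
Variables (R : realType) (d : nat) (M : smooth_manifold R d).

Definition chart_at (x : M) : chart_index M := projT1 (cid (dom_cover x)).

(* T*_x M: a cotangent vector at x is identified with the column of its
   components in the preferred chart [chart_at x]. The preferred chart need not
   depend continuously on x; the smooth structure of T*M is carried by
   [covector] and [Tsmooth] below. *)
Definition cotangent (x : M) : normedModType R := 'cV[R]_d.

(* The cotangent vector at x whose components in the chart i are eta. Tangent
   vectors are rows, transforming by v |-> v *m J with J the jacobian of the
   change of charts, so that invariance of the pairing v *m eta gives the rule
   below. *)
Definition covector (i : chart_index M) (x : M) (eta : 'cV[R]_d) :
    cotangent x :=
  jacobian (chart i \o chart_inv (chart_at x)) (chart (chart_at x) x) *m eta.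

(* Smoothness on T*M \ {0}, in the coordinates (y, eta) induced by the
   charts. *)
Definition Tsmooth (F : forall x : M, cotangent x -> R[i]) : Prop :=
  forall i : chart_index M,
    csmooth_on [set p : 'rV[R]_d * 'cV[R]_d |
                  (chart i @` dom i) p.1 /\ p.2 != 0]
      (fun p => F (chart_inv i p.1) (covector i (chart_inv i p.1) p.2)).

(* Principal symbols of pseudodifferential operators of order s acting on
   sections of the trivial bundle M x C^m: smooth m x m matrix-functions on
   T*M \ {0}, positively homogeneous of degree s in xi. Every such function is
   the principal symbol of some operator. The values at xi = 0 are junk. *)
Record principal_symbol (m : nat) (s : R) := PrincipalSymbol {
  symbol :> forall x : M, cotangent x -> 'M[R[i]]_m ;
  symbol_smooth : forall j k, Tsmooth (fun x xi => symbol xi j k) ;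
  symbol_homogeneous : forall (x : M) (xi : cotangent x) (t : R),
    xi != 0 -> 0 < t -> symbol (t *: xi) = (t `^ s)%:C *: symbol xi
}.

End CotangentBundle.

Definition simple_eigenvalues (R : realType) (m : nat) (A : 'M[R[i]]_m) :=
  forall a : R[i], eigenvalue A a -> mup a (char_poly A) = 1%N.

(* The complex projective space CP^(m-1) of lines through the origin of C^m. *)
Record projective_space (R : realType) (m : nat) := ProjectiveLine {
  line :> {vspace 'cV[R[i]]_m} ;
  line_dim : \dim line == 1%N
}.

Section ProjectiveTopology.
Variables (R : realType) (m : nat).
Local Notation CP := (projective_space R m).

HB.instance Definition _ := [isSub for @line R m].
HB.instance Definition _ := [Choice of CP by <:].

(* The quotient topology: U is open when its inverse image under the map
   C^m \ {0} -> CP^(m-1) sending v to the line spanned by v is open; C^m \ {0}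
   being open, this means open in C^m. *)
Definition projective_preimage (U : set CP) : set 'cV[R[i]]_m :=
  [set v | v != 0 /\ exists2 L : CP, U L & line L = <[v]>%VS].

Definition projective_open (U : set CP) : Prop :=
  open (projective_preimage U : set 'cV[R[i]^o]_m).

Lemma projective_openT : projective_open [set: CP].
Proof.
rewrite /projective_open.
suff -> : projective_preimage [set: CP] = ~` [set 0].
  apply: (@closed_openC 'cV[R[i]^o]_m); apply: accessible_closed_set1.
  exact/hausdorff_accessible/norm_hausdorff.
apply/seteqP; split=> v /=; first by move=> [/eqP].
move=> /eqP v0; have dv : \dim <[v]>%VS == 1%N by rewrite dim_vline v0.
by split=> //; exists (ProjectiveLine dv).
Qed.

Lemma projective_openI : setI_closed projective_open.
Proof.
move=> U V oU oV; rewrite /projective_open.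
suff -> : projective_preimage (U `&` V) =
    projective_preimage U `&` projective_preimage V by exact: openI.
apply/seteqP; split=> v /=.
  by move=> [v0 [L [UL VL] Lv]]; split; split=> //; exists L.
move=> [[v0 [L UL Lv]] [_ [L' VL' L'v]]]; split=> //; exists L => //.
by split=> //; rewrite (_ : L = L') //; apply: val_inj; rewrite /= Lv.
Qed.

Lemma projective_open_bigU (I : Type) (f : I -> set CP) :
  (forall i, projective_open (f i)) -> projective_open (\bigcup_i f i).
Proof.
move=> of_; rewrite /projective_open.
suff -> : projective_preimage (\bigcup_i f i) =
    \bigcup_i projective_preimage (f i) by apply: bigcup_open => i _; exact: of_.
apply/seteqP; split=> v /=.
  by move=> [v0 [L [i _ fiL] Lv]]; exists i => //; split=> //; exists L.
by move=> [i _ [v0 [L fiL Lv]]]; split=> //; exists L => //; exists i.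
Qed.

HB.instance Definition _ := isOpenTopological.Build CP
  projective_openT projective_openI projective_open_bigU.

End ProjectiveTopology.

(* The restriction of f to the subspace X is homotopic to a constant map. *)
Definition nullhomotopic_on (R : realType) (X Y : topologicalType) (D : set X)
    (f : X -> Y) : Prop :=
  exists (c : Y) (H : R * X -> Y),
    [/\ {within `[0, 1] `*` D, continuous H},
        forall x, D x -> H (0, x) = f x &
        forall x, D x -> H (1, x) = c].

(* Main.v *)
(* The eigenspaces form a line field on R^d \ {0}, homogeneous of degree 0, i.e. a
   complex line bundle over a sphere of dimension d - 1, and the question is whether
   it has a nonvanishing section; a continuous section can be smoothed, because the
   adjugate of h - A is smooth and proportional to the eigenprojection.

   A homotopy of line fields lifts to vectors: over a compact base, nearby lines are
   not orthogonal, so one may project successively along a fine subdivision of the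
   time interval. Lifting a contraction settles the null-homotopic case. In
   general, lift along the meridians from the south pole to the north pole of the
   sphere: at the north pole this yields a map from the equator S^(d-2) to C \ {0},
   and if it has a continuous argument the lift can be rotated so as to close up. The
   argument exists trivially for S^0, and for S^k, k >= 2, by lifting it along the
   meridians again: at the north pole it is locally constant on the connected sphere
   S^(k-1). This leaves out only d = 3.

   Conversely, if d = 3, a smooth section restricted to the sphere S^2 is a Lipschitz
   map into C^m with 2 m >= 4 > 3, so it is never opposite to a suitable vector w, and
   the segments from the section to w give a homotopy of lines to a constant. *)
Require Import Defs.
From HB Require Import structures.
From mathcomp Require Import all_boot all_order all_algebra.
From mathcomp Require Import complex.
From mathcomp Require Import all_classical all_reals all_analysis.
From mathcomp Require Import perm ring lra.
Import numFieldNormedType.Exports.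
Set Implicit Arguments.
Unset Strict Implicit.
Unset Printing Implicit Defensive.
Import Order.TTheory GRing.Theory Num.Theory.
Local Open Scope classical_set_scope.
Local Open Scope ring_scope.
Local Open Scope complex_scope.
Local Open Scope sesquilinear_scope.

(** * Continuity of complex vectors and matrices *)

Section ComplexContinuity.
Variable R : realType.
Local Notation C := R[i].

(** The obstruction is a winding number. Lifting along meridians leaves a map from the equator to C
    \ {0}, and a circle is the only equator on which such a map can wind around 0; for d = 3 the
    number of turns is, up to sign, the first Chern number of the eigenline bundle over S^2. The
    unit sphere is taken for the maximum norm, so it is the surface of a cube. Its flat faces make
    the cells of the counting argument convex, and the mean value theorem applies inside each; the
    Euclidean norm enters only where weights must be smooth. For d = 3 the vectors opposite to a
    value of the section form a cone. In the affine 3-space where the first real coordinate is 1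
    this cone leaves a trace of dimension at most 2, so O(n^2) small pieces face n^3 grid points: a
    count takes the place of a measure argument. *)

Definition ccont (T : topologicalType) (f : T -> C) (x : T) : Prop :=
  {for x, continuous (fun y => complex.Re (f y))} /\
  {for x, continuous (fun y => complex.Im (f y))}.

Lemma continuous_near_eq (T U : topologicalType) (f g : T -> U) (x : T) :
  (\forall y \near x, f y = g y) -> {for x, continuous f} -> {for x, continuous g}.
Proof.
move=> fg cf; rewrite /prop_for /continuous_at -(nbhs_singleton fg).
by apply: cvg_trans cf; apply: near_eq_cvg; apply: filterS fg => y ->.
Qed.

Section Closure.
Variable T : topologicalType.
Implicit Types (f g : T -> C) (x : T).

Lemma ccont_cst (c : C) x : ccont (fun=> c) x.
Proof. by split; exact: cst_continuous. Qed.

Lemma ccont_real (r : T -> R) x : {for x, continuous r} ->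
  ccont (fun y => (r y)%:C) x.
Proof. by move=> cr; split => //; exact: cst_continuous. Qed.

Lemma ccontD f g x : ccont f x -> ccont g x -> ccont (fun y => f y + g y) x.
Proof.
move=> [f1 f2] [g1 g2]; split.
  rewrite (_ : (fun y => _) = (fun y => complex.Re (f y) + complex.Re (g y))).
    exact: continuousD.
  by apply/funext => y; case: (f y) (g y) => ? ? [].
rewrite (_ : (fun y => _) = (fun y => complex.Im (f y) + complex.Im (g y))).
  exact: continuousD.
by apply/funext => y; case: (f y) (g y) => ? ? [].
Qed.

Lemma ccontM f g x : ccont f x -> ccont g x -> ccont (fun y => f y * g y) x.
Proof.
move=> [f1 f2] [g1 g2]; split.
  rewrite (_ : (fun y => _) = (fun y => complex.Re (f y) * complex.Re (g y) -
      complex.Im (f y) * complex.Im (g y))).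
    by apply: continuousB; apply: continuousM.
  by apply/funext => y; case: (f y) (g y) => ? ? [].
rewrite (_ : (fun y => _) = (fun y => complex.Re (f y) * complex.Im (g y) +
    complex.Im (f y) * complex.Re (g y))).
  by apply: continuousD; apply: continuousM.
by apply/funext => y; case: (f y) (g y) => ? ? [].
Qed.

Lemma ccont_conj f x : ccont f x -> ccont (fun y => (f y)^*%R) x.
Proof.
move=> [f1 f2]; split.
  rewrite (_ : (fun y => _) = (fun y => complex.Re (f y))) //.
  by apply/funext => y; case: (f y).
rewrite (_ : (fun y => _) = (fun y => - complex.Im (f y))).
  exact: continuousN.
by apply/funext => y; case: (f y).
Qed.

Lemma ccontV f x : f x != 0 -> ccont f x -> ccont (fun y => (f y)^-1) x.
Proof.
move=> fx0 [f1 f2].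
pose n2 y := complex.Re (f y) ^+ 2 + complex.Im (f y) ^+ 2.
have n2x : n2 x != 0.
  rewrite /n2; case: (f x) fx0 => a b /=; apply: contraNneq.
  by move=> /eqP; rewrite paddr_eq0 ?sqr_ge0 // !sqrf_eq0 => /andP[/eqP-> /eqP->].
have cn2 : {for x, continuous n2}.
  by apply: continuousD; apply: continuousM.
have cn2V : {for x, continuous (fun y => (n2 y)^-1)} by apply: continuousV.
split.
  rewrite (_ : (fun y => _) = (fun y => complex.Re (f y) * (n2 y)^-1)).
    exact: continuousM.
  by apply/funext => y; rewrite /n2; case: (f y).
rewrite (_ : (fun y => _) = (fun y => - (complex.Im (f y) * (n2 y)^-1))).
  by apply: continuousN; apply: continuousM.
by apply/funext => y; rewrite /n2; case: (f y).
Qed.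

Lemma ccont_sum (I : Type) (r : seq I) (P : pred I) (F : I -> T -> C) x :
  (forall i, P i -> ccont (F i) x) ->
  ccont (fun y => \sum_(i <- r | P i) F i y) x.
Proof.
move=> cF; elim: r => [|i r IH].
  rewrite (_ : (fun y => _) = fun=> 0); first exact: ccont_cst.
  by apply/funext => y; rewrite big_nil.
case Pi : (P i); last first.
  rewrite (_ : (fun y => _) = fun y => \sum_(i <- r | P i) F i y) //.
  by apply/funext => y; rewrite big_cons Pi.
rewrite (_ : (fun y => _) = fun y => F i y + \sum_(i <- r | P i) F i y).
  by apply: ccontD => //; exact: cF.
by apply/funext => y; rewrite big_cons Pi.
Qed.

Lemma ccont_near_eq f g x : (\forall y \near x, f y = g y) ->
  ccont f x -> ccont g x.
Proof.
move=> fg [f1 f2]; split.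
  by apply: continuous_near_eq f1; apply: filterS fg => y ->.
by apply: continuous_near_eq f2; apply: filterS fg => y ->.
Qed.

End Closure.

Lemma ccont_comp (S T : topologicalType) (g : S -> T) (f : T -> C) x :
  {for x, continuous g} -> ccont f (g x) -> ccont (fun y => f (g y)) x.
Proof.
move=> cg [f1 f2]; split.
  exact: (continuous_comp cg f1).
exact: (continuous_comp cg f2).
Qed.

Definition mcont (T : topologicalType) (m n : nat) (F : T -> 'M[C]_(m, n)) x :=
  forall i j, ccont (fun y => F y i j) x.

Section MatrixClosure.
Variable T : topologicalType.

Lemma mcont_cst m n (A : 'M[C]_(m, n)) (x : T) : mcont (fun=> A) x.
Proof. by move=> i j; exact: ccont_cst. Qed.

Lemma mcontD m n (F G : T -> 'M[C]_(m, n)) x :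
  mcont F x -> mcont G x -> mcont (fun y => F y + G y) x.
Proof.
move=> cF cG i j; rewrite (_ : (fun y => _) = fun y => F y i j + G y i j).
  exact: ccontD.
by apply/funext => y; rewrite mxE.
Qed.

Lemma mcontM m n p (F : T -> 'M[C]_(m, n)) (G : T -> 'M[C]_(n, p)) x :
  mcont F x -> mcont G x -> mcont (fun y => F y *m G y) x.
Proof.
move=> cF cG i j.
rewrite (_ : (fun y => _) = fun y => \sum_k F y i k * G y k j).
  by apply: ccont_sum => k _; exact: ccontM.
by apply/funext => y; rewrite mxE.
Qed.

Lemma mcontZ m n (f : T -> C) (F : T -> 'M[C]_(m, n)) x :
  ccont f x -> mcont F x -> mcont (fun y => f y *: F y) x.
Proof.
move=> cf cF i j; rewrite (_ : (fun y => _) = fun y => f y * F y i j).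
  exact: ccontM.
by apply/funext => y; rewrite mxE.
Qed.

Lemma mcont_adjoint m n (F : T -> 'M[C]_(m, n)) x :
  mcont F x -> mcont (fun y => (F y)^t*) x.
Proof.
move=> cF i j; rewrite (_ : (fun y => _) = fun y => (F y j i)^*%R).
  exact: ccont_conj.
by apply/funext => y; rewrite !mxE.
Qed.

Lemma mcont_near_eq m n (F G : T -> 'M[C]_(m, n)) x :
  (\forall y \near x, F y = G y) -> mcont F x -> mcont G x.
Proof.
move=> FG cF i j; apply: ccont_near_eq (cF i j).
by apply: filterS FG => y ->.
Qed.

End MatrixClosure.

Lemma mcont_comp (S T : topologicalType) m n (g : S -> T) (F : T -> 'M[C]_(m, n))
    x :
  {for x, continuous g} -> mcont F (g x) -> mcont (fun y => F (g y)) x.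
Proof. by move=> cg cF i j; apply: (ccont_comp (f := fun z => F z i j)). Qed.

End ComplexContinuity.

(** * Orthogonal projections onto complex lines *)

Section LineProjection.
Variables (R : realType) (m : nat).
Local Notation C := R[i].
Implicit Types v w : 'cV[C]_m.

Definition hdot v w : C := (v^t* *m w) 0 0.

Lemma hdotE v w : hdot v w = \sum_k (v k 0)^*%R * w k 0.
Proof. by rewrite /hdot mxE; apply: eq_bigr => k _; rewrite !mxE. Qed.

Lemma hdot_ge0 v : 0 <= hdot v v.
Proof.
by rewrite hdotE sumr_ge0 // => k _; rewrite mulrC mul_conjC_ge0.
Qed.

Lemma hdot_eq0 v : (hdot v v == 0) = (v == 0).
Proof.
apply/eqP/eqP => [|->]; last by rewrite hdotE big1 // => k _; rewrite !mxE mulr0.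
rewrite hdotE => /eqP; rewrite psumr_eq0; last first.
  by move=> k _; rewrite mulrC mul_conjC_ge0.
move=> /allP h; apply/matrixP => k j; rewrite ord1 mxE; apply/eqP.
have /implyP/(_ isT) := h k (mem_index_enum k).
by rewrite mulrC mul_conjC_eq0.
Qed.

Lemma hdot_gt0 v : v != 0 -> 0 < hdot v v.
Proof. by move=> v0; rewrite lt_neqAle eq_sym hdot_eq0 v0 hdot_ge0. Qed.

Lemma hdotZr a v w : hdot v (a *: w) = a * hdot v w.
Proof. by rewrite /hdot -scalemxAr mxE. Qed.

Lemma hdotZl a v w : hdot (a *: v) w = a^*%R * hdot v w.
Proof.
rewrite !hdotE mulr_sumr; apply: eq_bigr => k _.
by rewrite mxE rmorphM /= mulrA.
Qed.

Lemma hdot_sumr (I : Type) (r : seq I) (P : pred I) v (F : I -> 'cV[C]_m) :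
  hdot v (\sum_(i <- r | P i) F i) = \sum_(i <- r | P i) hdot v (F i).
Proof. by rewrite /hdot mulmx_sumr summxE. Qed.

(** The orthogonal projection onto the line of [v] for the standard Hermitian product; it is 0 for
    [v = 0], because [0^-1 = 0]. By [lprojZ] it depends on the line alone. *)
Definition lproj v : 'M[C]_m := (hdot v v)^-1 *: (v *m v^t*).

Lemma mul_col_adj v w : v *m v^t* *m w = hdot v w *: v.
Proof.
rewrite -mulmxA; apply/matrixP => i j; by rewrite ord1 [LHS]mxE [RHS]mxE big_ord1
  mulrC.
Qed.

Lemma lprojE v w : lproj v *m w = (hdot v w / hdot v v) *: v.
Proof. by rewrite /lproj -scalemxAl mul_col_adj scalerA mulrC. Qed.

Lemma lproj_id v : lproj v *m v = v.
Proof.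
have [->|v0] := eqVneq v 0; first by rewrite mulmx0.
by rewrite lprojE divff ?hdot_eq0 // scale1r.
Qed.

Lemma lprojZ a v : a != 0 -> lproj (a *: v) = lproj v.
Proof.
move=> a0; rewrite /lproj hdotZl hdotZr -scalemxAl.
rewrite (_ : (a *: v)^t* = a^*%R *: v^t*); last first.
  by apply/matrixP => i j; rewrite !mxE rmorphM.
rewrite -scalemxAr !scalerA; congr (_ *: _).
have a0' : a^*%R != 0 by rewrite conjC_eq0.
have aV : a / a = 1 by rewrite divff.
have aV' : a^*%R / a^*%R = 1 by rewrite divff.
rewrite !invfM -[RHS]mulr1 -[RHS]mulr1 -{1}aV -aV'.
by move: (hdot v v)^-1 (a^*%R) (a^-1) (a^*%R^-1) => z b c e; ring.
Qed.

Lemma mcont_lproj (T : topologicalType) (F : T -> 'cV[C]_m) x :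
  F x != 0 -> mcont F x -> mcont (fun y => lproj (F y)) x.
Proof.
move=> F0 cF; rewrite /lproj.
apply: (mcontZ (f := fun y => (hdot (F y) (F y))^-1) (F := fun y => F y *m (F y)^t*)).
  apply: ccontV; first by rewrite hdot_eq0.
  exact: (mcontM (mcont_adjoint cF) cF).
exact: (mcontM cF (mcont_adjoint cF)).
Qed.

End LineProjection.

(** * Uniform continuity and the compact unit sphere *)

Section UniformContinuity.
Variable R : realType.

Lemma continuous_mx (K : numFieldType) (T : topologicalType) (m n : nat)
    (F : T -> 'M[K]_(m, n)) (x : T) :
  (forall i j, {for x, continuous (fun y => F y i j)}) -> {for x, continuous F}.
Proof.
move=> cF U [P nP PU]; rewrite /= nbhs_simpl /=.
have : \forall y \near x, forall i j, P i j (F y i j).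
  apply: filter_forall => i; apply: filter_forall => j; exact: (cF i j _ (nP i j)).
by apply: filterS => y Py; exact: PU.
Qed.

Lemma continuous_scale (T : topologicalType) (V : normedModType R) (k : T -> R)
    (f : T -> V) (x : T) : {for x, continuous k} -> {for x, continuous f} ->
  {for x, continuous (fun y => k y *: f y)}.
Proof. by move=> ck cf; apply: cvgZ. Qed.

Lemma continuous_dist (T : topologicalType) (f : T -> R) (x : T) :
  {for x, continuous f} <->
  forall e : R, 0 < e -> \forall y \near x, `|f x - f y| < e.
Proof. exact: cvgrPdist_lt. Qed.

(** Only the first point is confined to [K]: continuity at the points of [K] is meant in the ambient
    space, so the second point may leave [K]. *)
Lemma compact_uniform (X : pseudoMetricType R) (K : set X) (F : X -> R) :
  compact K -> (forall x, K x -> {for x, continuous F}) ->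
  forall e : R, 0 < e -> exists2 d : R, 0 < d &
    forall x y, K x -> ball x d y -> `|F x - F y| < e.
Proof.
move=> /compact_near_coveringP cK cF e e0.
pose P (d : R) (x : X) := forall y, ball x d y -> `|F x - F y| < e.
have [x Kx|d /= d0 h] := cK R 0^'+ P _.
  have e2 : 0 < e / 2 by rewrite divr_gt0.
  have nF : nbhs x [set y | `|F x - F y| < e / 2].
    exact: (cvgr_dist_lt _ _ (cF x Kx) _ e2).
  have [r /= r0 rF] := (nbhs_ballP _ _).1 nF.
  have r2 : 0 < r / 2 by rewrite divr_gt0.
  exists (ball x (r / 2), [set d | d < r / 2]).
    by split; [exact: nbhsx_ballx | exact: nbhs_right_lt].
  move=> [x' d] [/= xx' dr] y yx'.
  have h1 : `|F x - F x'| < e / 2 by apply: rF; apply: le_ball xx'; lra.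
  have h2 : `|F x - F y| < e / 2.
    apply: rF; rewrite (splitr r); apply: ball_triangle xx' _.
    by apply: le_ball yx'; exact: ltW.
  rewrite (_ : F x' - F y = (F x - F y) - (F x - F x')); last by lra.
  by rewrite (splitr e); apply: le_lt_trans (ler_normB _ _) (ltrD _ _).
have d2 : 0 < d / 2 by rewrite divr_gt0.
exists (d / 2) => // x y Kx; apply: h => //.
by rewrite /ball_ /= sub0r normrN gtr0_norm //; lra.
Qed.

Lemma coord_le_norm (m n : nat) (x : 'M[R]_(m, n)) i j : `|x i j| <= `|x|.
Proof.
by rewrite /Num.Def.normr /= mx_normrE; apply: (le_bigmax _ _ (i, j)).
Qed.

Lemma norm_coord (m n : nat) (x : 'M[R]_(m, n)) : x != 0 ->
  exists i j, `|x| = `|x i j|.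
Proof.
move=> x0; have [|[i j] /= h] := @mx_norm_neq0 _ _ _ x; last by exists i, j.
by apply: contra_neq x0 => /mx_norm_eq0.
Qed.

Lemma const_mx1_neq0 (n : nat) : const_mx 1 != 0 :> 'cV[R]_n.+1.
Proof.
by apply/eqP => /matrixP/(_ 0 0); rewrite !mxE => /eqP; rewrite oner_eq0.
Qed.

Lemma norm_const_mx1 (n : nat) : `|const_mx 1 : 'cV[R]_n.+1| = 1.
Proof.
by have [i [j ->]] := norm_coord (const_mx1_neq0 n); rewrite mxE normr1.
Qed.

(** The norm of a matrix is its largest entry in modulus, so this sphere is the surface of a cube,
    closed in a product of segments. *)
Lemma compact_sphere (n : nat) : compact [set x : 'cV[R]_n | `|x| = 1].
Proof.
have tr_c : continuous (fun v : 'rV[R]_n => v^T).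
  move=> v; apply: continuous_mx => i j.
  rewrite (_ : (fun y => _) = fun y : 'rV[R]_n => y j i).
    exact: coord_continuous.
  by apply/funext => y; rewrite mxE.
have cc : compact [set v : 'rV[R]_n | forall i, `[(-1 : R), 1]%classic (v ord0 i)].
  apply: (@rV_compact R n (fun=> `[(-1 : R), 1]%classic)) => i.
  exact: segment_compact.
apply: (subclosed_compact _ (continuous_compact (continuous_subspaceT tr_c) cc)).
  rewrite (_ : [set x | _] = (fun x : 'cV[R]_n => `|x|) @^-1` [set 1]) //.
  by apply: (continuous_closedP _).1 (@closed_eq R 1); exact: norm_continuous.
move=> x /= x1; exists x^T; last by rewrite trmxK.
move=> i /=; rewrite mxE in_itv /= -ler_norml -x1.
exact: coord_le_norm.
Qed.

End UniformContinuity.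

(** * Lifting along homotopies *)

Lemma continuous_pair (S T U : topologicalType) (f : S -> T) (g : S -> U) (x : S) :
  {for x, continuous f} -> {for x, continuous g} ->
  {for x, continuous (fun y => (f y, g y))}.
Proof. by move=> cf cg; apply: cvg_pair cf cg. Qed.

Lemma continuous_fst (S T : topologicalType) (z : S * T) :
  {for z, continuous (@fst S T)}.
Proof. by case: z => x y; exact: cvg_fst. Qed.

Lemma continuous_snd (S T : topologicalType) (z : S * T) :
  {for z, continuous (@snd S T)}.
Proof. by case: z => x y; exact: cvg_snd. Qed.

Lemma continuous_drop_fst (S T U : topologicalType) (z : S * T * U) :
  {for z, continuous (fun z : S * T * U => (z.1.2, z.2))}.
Proof.
apply: continuous_pair; last exact: continuous_snd.
exact: (continuous_comp (@continuous_fst _ _ z) (@continuous_snd _ _ z.1)).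
Qed.

Lemma continuous_drop_snd (S T U : topologicalType) (z : S * T * U) :
  {for z, continuous (fun z : S * T * U => (z.1.1, z.2))}.
Proof.
apply: continuous_pair; last exact: continuous_snd.
exact: (continuous_comp (@continuous_fst _ _ z) (@continuous_fst _ _ z.1)).
Qed.

Section Lift.
Variable R : realType.
Local Notation C := R[i].

(** The retraction of the line onto [0, 1]. Paths composed with it are continuous at every real
    time, which avoids one-sided continuity at the endpoints. *)
Definition clamp (t : R) : R := Num.max 0 (Num.min 1 t).

Lemma clamp_itv t : 0 <= clamp t <= 1.
Proof.
rewrite /clamp le_max lexx /= ge_max ler01 /=.
by rewrite ge_min lexx.
Qed.

Lemma clamp_id t : 0 <= t <= 1 -> clamp t = t.
Proof. by move=> /andP[t0 t1]; rewrite /clamp min_r // max_r. Qed.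

Lemma clamp_continuous : continuous clamp.
Proof.
move=> t; apply: continuous_max; first exact: cst_continuous.
by apply: continuous_min => //; exact: cst_continuous.
Qed.

Lemma clamp_lip s t : `|clamp s - clamp t| <= `|s - t|.
Proof.
have H x : [\/ x <= 0 /\ clamp x = 0, 0 <= x <= 1 /\ clamp x = x |
  1 <= x /\ clamp x = 1].
  have [x0|x0] := leP x 0.
    by apply: Or31; rewrite /clamp min_r ?max_l //; lra.
  have [x1|x1] := leP 1 x.
    by apply: Or33; rewrite /clamp min_l // max_r.
  by apply: Or32; split; [lra | rewrite clamp_id //; lra].
have nn : - `|s - t| <= s - t <= `|s - t| by rewrite -ler_norml.
by rewrite ler_norml; case: (H s) => [] [hs ->]; case: (H t) => [] [ht ->]; lra.
Qed.

Lemma minr_continuous (a : R) : continuous (fun t : R => Num.min t a).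
Proof. by move=> t; apply: continuous_min => //; exact: cst_continuous. Qed.

Variables (T : topologicalType) (U : set T).

(** The times [min t (k / (N + 1))] lead from 0 to [t] in short steps and depend continuously on
    [t]; having reached [t], they stay there. *)
Lemma min_node (N k : nat) (t : R) : 0 <= t <= 1 -> (k <= N.+1)%N ->
  0 <= Num.min t (k%:R / N.+1%:R) <= 1.
Proof.
move=> t01 kN; have : 0 <= (k%:R / N.+1%:R : R) by rewrite divr_ge0.
rewrite le_min ge_min => ->; lra.
Qed.

Lemma min_node_step (N k : nat) (t : R) :
  `|Num.min t (k%:R / N.+1%:R) - Num.min t (k.+1%:R / N.+1%:R)| <= N.+1%:R^-1 :> R.
Proof.
have -> : k.+1%:R / N.+1%:R = k%:R / N.+1%:R + N.+1%:R^-1 :> R.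
  by rewrite -natr1 mulrDl mul1r.
have : 0 < N.+1%:R^-1 :> R by rewrite invr_gt0.
move: (N.+1%:R^-1 : R) (k%:R : R) => b c b0; set a := c * b.
by rewrite ler_norml; case: (leP t a) => ?; case: (leP t (a + b)) => ?; lra.
Qed.

(** Truncating the nodes at [t] turns the product of projections into one formula continuous in
    [(t, x)], with nothing to glue at the nodes. The factors whose node exceeds [t] all equal
    [Q t x], and idempotence makes the repetition harmless. *)
Lemma lift_line (m : nat) (Q : R -> T -> 'M[C]_m) (v0 : T -> 'cV[C]_m) (N : nat) :
  (forall t x, U x -> mcont (fun z : R * T => Q z.1 z.2) (t, x)) ->
  (forall t x (w : 'cV[C]_m), U x -> Q t x *m (Q t x *m w) = Q t x *m w) ->
  (forall t t' x (w : 'cV[C]_m), U x -> 0 <= t <= 1 -> 0 <= t' <= 1 ->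
     `|t - t'| <= N.+1%:R^-1 -> Q t x *m w = w -> w != 0 -> Q t' x *m w != 0) ->
  (forall x, U x -> mcont v0 x) ->
  (forall x, U x -> v0 x != 0 /\ Q 0 x *m v0 x = v0 x) ->
  exists V : R -> T -> 'cV[C]_m,
    [/\ forall t x, U x -> mcont (fun z : R * T => V z.1 z.2) (t, x),
        forall x, U x -> V 0 x = v0 x &
        forall t x, U x -> 0 <= t <= 1 -> V t x != 0 /\ Q t x *m V t x = V t x].
Proof.
move=> Qc Qid Qn v0c v0P.
(* Project successively on the lines at the times k / (N + 1) before t. *)
pose fix V k : R -> T -> 'cV[C]_m := if k is k'.+1 then
  fun t x => Q (Num.min t (k%:R / N.+1%:R)) x *m V k' t x else fun=> v0.
have Vc k t x : U x -> mcont (fun z : R * T => V k z.1 z.2) (t, x).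
  move=> Ux; elim: k => [|k IH] /=.
    by apply: (mcont_comp (F := v0) (g := snd)); [exact: continuous_snd | exact: v0c].
  apply: mcontM => //.
  apply: (mcont_comp (F := fun z : R * T => Q z.1 z.2)
    (g := fun z : R * T => (Num.min z.1 (k.+1%:R / N.+1%:R), z.2))); last exact: Qc.
  apply: continuous_pair; last exact: continuous_snd.
  by apply: (continuous_comp (f := fst) _ (@minr_continuous _ _)); exact:
    continuous_fst.
have V0 k x : U x -> V k 0 x = v0 x.
  move=> Ux; elim: k => //= k ->.
  rewrite min_l ?divr_ge0 //; exact: (v0P x Ux).2.
have Vk k t x : U x -> 0 <= t <= 1 -> (k <= N.+1)%N -> V k t x != 0 /\
    Q (Num.min t (k%:R / N.+1%:R)) x *m V k t x = V k t x.
  move=> Ux t01; elim: k => [_|k IH kN] /=.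
    by rewrite mul0r min_r; [exact: v0P | lra].
  have [Vn VQ] := IH (ltnW kN); split; last exact: Qid.
  apply: (Qn (Num.min t (k%:R / N.+1%:R))) => //.
  - exact/min_node/ltnW.
  - exact: min_node.
  - exact: min_node_step.
exists (V N.+1); split; [by move=> t x; exact: Vc | by move=> x; exact: V0 |].
move=> t x Ux t01; have := Vk N.+1 t x Ux t01 (leqnn _).
by rewrite divff ?pnatr_eq0 // min_l //; lra.
Qed.

Definition expi (a : R) : C := cos a +i* sin a.

Lemma expiD a b : expi (a + b) = expi a * expi b.
Proof.
by rewrite /expi cosD sinD; apply/eqP; rewrite eq_complex /= addrC [X in _ && (_ ==
  X)]addrC; apply/andP; split; apply/eqP; ring.
Qed.

Lemma expi0 : expi 0 = 1.
Proof. by rewrite /expi cos0 sin0. Qed.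

(** The principal argument on the half-plane Re z > 0, the only place where it is used as an
    argument. *)
Definition catan (z : C) : R := atan (complex.Im z / complex.Re z).

Lemma catanP z : 0 < complex.Re z ->
  exists2 r : R, 0 < r & z = r%:C * expi (catan z).
Proof.
case: z => a b /= a0; rewrite /catan /=; set u := b / a.
have c0 : 0 < cos (atan u).
  by rewrite cos_atan invr_gt0 sqrtr_gt0 ltr_wpDr ?sqr_ge0.
exists (a / cos (atan u)); first by rewrite divr_gt0.
have tu : sin (atan u) = u * cos (atan u).
  by rewrite -[X in X * _]atanK /tan divfK // gt_eqF.
apply/eqP; rewrite eq_complex /= tu; move: (cos (atan u)) c0 => k k0.
have [a0' k0'] : a != 0 /\ k != 0 by rewrite !gt_eqF.
by rewrite /u; apply/andP; split; apply/eqP; field; rewrite ?a0' ?k0'.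
Qed.

(** Over one step the quotient of successive values stays in the half-plane Re z > 0, where [catan]
    is a continuous argument; the increments add up to an argument of [g t x / g 0 x]. *)
Lemma lift_angle (g : R -> T -> C) (N : nat) :
  (forall t x, U x -> ccont (fun z : R * T => g z.1 z.2) (t, x)) ->
  (forall t x, U x -> g t x != 0) ->
  (forall t t' x, U x -> `|t - t'| <= N.+1%:R^-1 ->
     0 < complex.Re (g t' x / g t x)) ->
  exists a : R -> T -> R,
    [/\ forall t x, U x -> {for (t, x), continuous (fun z : R * T => a z.1 z.2)},
        forall x, U x -> a 0 x = 0 &
        forall t x, U x -> 0 <= t <= 1 ->
          exists2 r : R, 0 < r & g t x = g 0 x * r%:C * expi (a t x)].
Proof.
move=> gc g0 gr.
pose s k t : R := Num.min t (k%:R / N.+1%:R).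
pose q k t x := g (s k.+1 t) x / g (s k t) x.
pose fix a k : R -> T -> R := if k is k'.+1 then
  fun t x => a k' t x + catan (q k' t x) else fun _ _ => 0.
have qp k t x : U x -> 0 < complex.Re (q k t x).
  by move=> Ux; apply: gr => //; exact: min_node_step.
have sc k t x : U x -> ccont (fun z : R * T => g (s k z.1) z.2) (t, x).
  move=> Ux; apply: (ccont_comp (f := fun z : R * T => g z.1 z.2)
    (g := fun z : R * T => (s k z.1, z.2))); last exact: gc.
  apply: continuous_pair; last exact: continuous_snd.
  by apply: (continuous_comp (f := fst) _ (@minr_continuous _ _)); exact:
    continuous_fst.
have qc k t x : U x ->
    {for (t, x), continuous (fun z : R * T => catan (q k z.1 z.2))}.
  move=> Ux; have [q1 q2] : ccont (fun z : R * T => q k z.1 z.2) (t, x).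
    by apply: ccontM; [exact: sc | apply: ccontV; [exact: g0 | exact: sc]].
  apply: (continuous_comp (g := atan)); last exact: continuous_atan.
  by apply: continuousM => //; apply: continuousV => //=; rewrite gt_eqF // qp.
exists (a N.+1); split.
- move=> t x Ux; elim: (N.+1) => [|k IH] /=; first exact: cst_continuous.
  by apply: continuousD => //; exact: qc.
- move=> x Ux; elim: (N.+1) => //= k ->; rewrite add0r /q /s !min_l ?divr_ge0 //.
  by rewrite divff ?g0 // /catan /= mul0r atan0.
- move=> t x Ux t01.
  have main k : exists2 r : R, 0 < r & g (s k t) x = g 0 x * r%:C * expi (a k t x).
    elim: k => [|k [r r0 IH]] /=.
      exists 1 => //; rewrite /s mul0r min_r; last by lra.
      by rewrite expi0 !mulr1.
    have [r' r'0 qE] := catanP (qp k t x Ux).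
    exists (r * r'); first exact: mulr_gt0.
    have -> : g (s k.+1 t) x = g (s k t) x * q k t x.
      by rewrite /q mulrC divfK // g0.
    rewrite IH {1}qE expiD (rmorphM (real_complex R)) /=.
    by rewrite -!mulrA; congr (_ * (_ * _)); rewrite mulrCA.
  have := main N.+1; rewrite {1}/s divff ?pnatr_eq0 // min_l //; lra.
Qed.

End Lift.

(** * Line fields on R^d minus the origin, d <> 3 *)

Section Join.
Variable R : realType.
Local Notation C := R[i].

(** Being 1 on the diagonal, [Phi] stays positive where it varies by less than 1; compactness makes
    the mesh uniform in [t] and [x]. *)
Lemma unif_diag (n : nat) (Phi : R -> R -> 'cV[R]_n -> R) :
  (forall t t' x, `|x| = 1 ->
     {for ((t, t'), x), continuous (fun z : R * R * 'cV[R]_n =>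
       Phi z.1.1 z.1.2 z.2)}) ->
  (forall t x, `|x| = 1 -> Phi t t x = 1) ->
  exists N : nat, forall t t' x, `|x| = 1 -> 0 <= t <= 1 ->
    `|t - t'| <= N.+1%:R^-1 -> 0 < Phi t t' x.
Proof.
move=> cP P1.
pose K := ((`[0, 1] `*` `[0, 1]) `*` [set x : 'cV[R]_n | `|x| = 1] :
  set (R * R * 'cV[R]_n))%classic.
have cK : compact K.
  apply: compact_setX; last exact: compact_sphere.
  by apply: compact_setX; exact: segment_compact.
have [|d d0 h] := @compact_uniform R (R * R * 'cV[R]_n)%type K (fun z =>
  Phi z.1.1 z.1.2 z.2) cK _ 1 ltr01.
  by move=> [[t t'] x] [_ /= x1]; exact: cP.
have [N Nd] : exists N : nat, N.+1%:R^-1 < d.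
  have := @ltr_add_invr R 0 d d0; case => N; rewrite add0r => ?; by exists N.
exists N => t t' x x1 t01 tt'.
have := h ((t, t), x) ((t, t'), x).
have tI : `[0, 1]%classic t by rewrite /= in_itv.
move=> /(_ (conj (conj tI tI) x1)) /=; rewrite P1 //.
have H : ball ((t, t), x) d ((t, t'), x).
  by split; [split; [exact: ballxx | exact: le_lt_trans tt' Nd] | exact: ballxx].
by move=> /(_ H); rewrite ltr_distlC; lra.
Qed.

Definition unitize (n : nat) (x : 'cV[R]_n) : 'cV[R]_n := `|x|^-1 *: x.

Lemma norm_unitize n (x : 'cV[R]_n) : x != 0 -> `|unitize x| = 1.
Proof. by move=> x0; rewrite normrZ normfV normr_id mulVf ?normr_eq0. Qed.

Lemma unitize_id n (x : 'cV[R]_n) : `|x| = 1 -> unitize x = x.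
Proof. by rewrite /unitize => ->; rewrite invr1 scale1r. Qed.

Lemma norm1_neq0 n (x : 'cV[R]_n) : `|x| = 1 -> x != 0.
Proof. by move=> x1; rewrite -normr_eq0 x1 oner_eq0. Qed.

Lemma unitize_continuous n (x : 'cV[R]_n) : x != 0 ->
  {for x, continuous (@unitize n)}.
Proof.
move=> x0; apply: continuous_scale => //.
  by apply: continuousV; [rewrite normr_eq0 | exact: norm_continuous].
Qed.

Variable n : nat.
Local Notation cV := 'cV[R]_(1 + n.+1).

(* For a unit vector y, the path t |-> jpath t y goes from the south pole -e_1
   to the north pole e_1 through the point (0, y) of the equator. Up to positive
   factors these paths cover R^(1+n) \ {0}; jt and jy are the coordinates. *)
Definition jpath (t : R) (y : 'cV[R]_n.+1) : cV :=
  col_mx (2 * t - 1)%:M ((1 - `|2 * t - 1|) *: y).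

Definition jt (x : cV) : R :=
  (1 + usubmx x 0 0 / (`|usubmx x 0 0| + `|dsubmx x|)) / 2.

(** At the poles the meridian is undetermined; [const_mx 1] is an arbitrary choice that keeps the
    norm equal to 1. *)
Definition jy (x : cV) : 'cV[R]_n.+1 :=
  unitize (if dsubmx x == 0 then const_mx 1 else dsubmx x).

Lemma norm_jy x : `|jy x| = 1.
Proof.
apply: norm_unitize; case: ifPn => // _; apply/eqP => /matrixP/(_ 0 0).
by rewrite !mxE => /eqP; rewrite oner_eq0.
Qed.

Lemma join_norm_gt0 (x : cV) : x != 0 -> 0 < `|usubmx x 0 0| + `|dsubmx x|.
Proof.
move=> x0; rewrite lt_neqAle addr_ge0 // andbT eq_sym.
apply: contra_neq x0 => /eqP; rewrite paddr_eq0 // !normr_eq0 =>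
  /andP[/eqP u0 /eqP d0].
rewrite -[x]vsubmxK d0 (_ : usubmx x = 0) ?col_mx0 //.
by apply/matrixP => i j; rewrite !ord1 u0 mxE.
Qed.

Lemma jt_itv x : x != 0 -> 0 <= jt x <= 1.
Proof.
move=> /join_norm_gt0; rewrite /jt; set s := usubmx x 0 0; set y := `|dsubmx x|.
move=> h; have : `|s / (`|s| + y)| <= 1.
  by rewrite normrM normfV (gtr0_norm h) ler_pdivrMr // mul1r lerDl normr_ge0.
by rewrite ler_norml; lra.
Qed.

Lemma jpath_jt x : x != 0 -> jpath (jt x) (jy x) = (`|usubmx x 0 0|
  + `|dsubmx x|)^-1 *: x.
Proof.
move=> x0; have := join_norm_gt0 x0; rewrite /jpath /jt.
set s := usubmx x 0 0; set y := `|dsubmx x|; set a := _ + y => a0.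
have -> : 2 * ((1 + s / a) / 2) - 1 = s / a by field; rewrite gt_eqF.
rewrite -[x in RHS]vsubmxK scale_col_mx; congr col_mx.
  by apply/matrixP => i j; rewrite !ord1 [LHS]mxE eqxx mulr1n [RHS]mxE mulrC.
rewrite normrM normfV (gtr0_norm a0) (_ : 1 - `|s| / a = a^-1 * y); last first.
  by rewrite /a; field; rewrite gt_eqF.
rewrite -scalerA; congr (_ *: _); rewrite /jy.
case: ifPn => [/eqP h|h]; first by rewrite /y h normr0 scale0r.
by rewrite /unitize scalerA divff ?scale1r // normr_eq0.
Qed.

Lemma jpath_neq0 t y : `|y| = 1 -> jpath t y != 0.
Proof.
move=> y1; apply/eqP => /matrixP h.
have h1 : 2 * t - 1 = 0.
  by have := h (lshift n.+1 0) 0; rewrite /jpath col_mxEu !mxE eqxx mulr1n.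
have : y = 0.
  apply/matrixP => i j; have := h (rshift 1 i) j.
  by rewrite /jpath col_mxEd h1 normr0 subr0 scale1r !mxE.
by apply/eqP/norm1_neq0.
Qed.

Lemma jpath0 y : jpath 0 y = col_mx (-1)%:M 0.
Proof. by rewrite /jpath mulr0 sub0r normrN normr1 subrr scale0r. Qed.

Lemma jpath1 y : jpath 1 y = col_mx 1%:M 0.
Proof.
by rewrite /jpath mulr1 (_ : 2 - 1 = 1); [rewrite normr1 subrr scale0r|lra].
Qed.

Lemma col_mx_continuous (T : topologicalType) (p q : nat) (f : T -> 'cV[R]_p)
    (g : T -> 'cV[R]_q) x :
  {for x, continuous f} -> {for x, continuous g} ->
  {for x, continuous (fun y => col_mx (f y) (g y))}.
Proof.
move=> cf cg; apply: continuous_mx => i j.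
case: (split_ordP i) => k ->.
  rewrite (_ : (fun y => _) = fun y => f y k j).
    by apply: (continuous_comp (g := fun M : 'cV[R]_p => M k j) cf); exact:
      coord_continuous.
  by apply/funext => y; rewrite col_mxEu.
rewrite (_ : (fun y => _) = fun y => g y k j).
  by apply: (continuous_comp (g := fun M : 'cV[R]_q => M k j) cg); exact:
    coord_continuous.
by apply/funext => y; rewrite col_mxEd.
Qed.

Lemma jpath_continuous (z : R * 'cV[R]_n.+1) :
  {for z, continuous (fun z : R * 'cV[R]_n.+1 => jpath z.1 z.2)}.
Proof.
have c1 : {for z, continuous (fun z : R * 'cV[R]_n.+1 => 2 * z.1 - 1)}.
  apply: continuousB; last exact: cst_continuous.
  by apply: continuousM; [exact: cst_continuous | exact: continuous_fst].
apply: col_mx_continuous.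
  apply: continuous_mx => i j; rewrite !ord1.
  rewrite (_ : (fun y => _) = fun z : R * 'cV[R]_n.+1 => 2 * z.1 - 1) //.
  by apply/funext => y; rewrite mxE eqxx mulr1n.
apply: continuous_scale; last exact: continuous_snd.
apply: continuousB; first exact: cst_continuous.
by apply: (continuous_comp c1); exact: norm_continuous.
Qed.

Lemma jpath_clamp_continuous (z : R * 'cV[R]_n.+1) :
  {for z, continuous (fun z : R * 'cV[R]_n.+1 => jpath (clamp z.1) z.2)}.
Proof.
apply: (continuous_comp (f := fun z : R * 'cV[R]_n.+1 => (clamp z.1, z.2))
  (g := fun z : R * 'cV[R]_n.+1 => jpath z.1 z.2)); last exact: jpath_continuous.
apply: continuous_pair; last exact: continuous_snd.
exact: (continuous_comp (@continuous_fst _ _ z) (@clamp_continuous R _)).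
Qed.

Lemma usub_continuous : continuous (fun x : cV => usubmx x 0 0).
Proof.
rewrite (_ : (fun x => _) = fun x : cV => x (lshift n.+1 0) 0).
  exact: coord_continuous.
by apply/funext => x; rewrite mxE.
Qed.

Lemma dsub_continuous : continuous (fun x : cV => dsubmx x).
Proof.
move=> x; apply: continuous_mx => i j.
rewrite (_ : (fun x => _) = fun x : cV => x (rshift 1 i) j).
  exact: coord_continuous.
by apply/funext => y; rewrite mxE.
Qed.

Lemma jt_continuous x : x != 0 -> {for x, continuous jt}.
Proof.
move=> x0; apply: continuousM; last exact: cst_continuous.
apply: continuousD; first exact: cst_continuous.
apply: continuousM; first exact: usub_continuous.
apply: continuousV; first by rewrite gt_eqF // join_norm_gt0.
apply: continuousD.
  by apply: (continuous_comp (@usub_continuous x)); exact: norm_continuous.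
by apply: (continuous_comp (@dsub_continuous x)); exact: norm_continuous.
Qed.

(** [jy] jumps at the poles, but there [F] does not depend on the direction, and its uniform
    continuity over the compact set of directions restores continuity. *)
Lemma pole_glue (F : R -> 'cV[R]_n.+1 -> R) (c0 c1 : R) :
  (forall t y, `|y| = 1 ->
     {for (t, y), continuous (fun z : R * 'cV[R]_n.+1 => F z.1 z.2)}) ->
  (forall y, `|y| = 1 -> F 0 y = c0) -> (forall y, `|y| = 1 -> F 1 y = c1) ->
  forall x, x != 0 -> {for x, continuous (fun x => F (jt x) (jy x))}.
Proof.
move=> cF F0 F1 x x0.
have [dx|dx] := eqVneq (dsubmx x) 0; last first.
  have cy : {for x, continuous (fun x => unitize (dsubmx x))}.
    by apply: (continuous_comp (g := @unitize _) (@dsub_continuous x)); exact: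
      unitize_continuous.
  have c : {for x, continuous (fun x => F (jt x) (unitize (dsubmx x)))}.
    apply: (continuous_comp (g := fun z => F z.1 z.2)
      (continuous_pair (jt_continuous x0) cy)).
    exact/cF/norm_unitize.
  apply: continuous_near_eq c.
  have : \forall y \near x, dsubmx y != 0.
    exact: (cvgr_neq0 _ (@dsub_continuous x) dx).
  by apply: filterS => y; rewrite /jy => /negbTE ->.
have [c Fc] : exists c, forall y, `|y| = 1 -> F (jt x) y = c.
  have : jt x = 0 \/ jt x = 1.
    have := join_norm_gt0 x0; rewrite /jt dx normr0 addr0.
    set s := usubmx x 0 0; rewrite normr_gt0 => s0.
    have [s1|s1] := ltP 0 s.
      by right; rewrite gtr0_norm // divff ?gt_eqF //; lra.
    left; rewrite ler0_norm // invrN mulrN divff // ?subrr ?mul0r //.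
  by move=> [->|->]; [exists c0 | exists c1].
apply/continuous_dist => e e0.
have cK : compact (`[0, 1] `*` [set y : 'cV[R]_n.+1 | `|y| = 1] :
  set (R * _))%classic.
  by apply: compact_setX; [exact: segment_compact | exact: compact_sphere].
have [|d d0 h] := @compact_uniform R (R * 'cV[R]_n.+1)%type _ (fun z =>
  F z.1 z.2) cK _ e e0.
  by move=> [t y] [_ /= y1]; exact: cF.
have nd : \forall y \near x, `|jt x - jt y| < d.
  exact: (continuous_dist _ _).1 (jt_continuous x0) _ d0.
(* At the pole the direction can be replaced by that of [y] without changing the value; only the
   time then differs. *)
apply: filterS nd => y dy; rewrite Fc ?norm_jy // -(Fc (jy y)) ?norm_jy //.
apply: (h (jt x, jy y) (jt y, jy y)).
  by split; [rewrite /= in_itv /=; exact: jt_itv | exact: norm_jy].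
by split; [exact: dy | exact: ballxx].
Qed.
End Join.

(** * Continuous arguments of nonvanishing functions on spheres *)

Section Angle.
Variable R : realType.
Local Notation C := R[i].

Lemma expi_pi (a : R) : expi (a + pi) = - expi a.
Proof. by rewrite /expi cosDpi sinDpi. Qed.

Lemma polar (c : C) : c != 0 -> exists2 r : R, 0 < r & exists a, c = r%:C * expi a.
Proof.
case: c => x y c0; have [x0|x0|x0] := ltrgtP x 0.
- have [|r r0 h] := @catanP R (- (x +i* y)); first by rewrite /= oppr_gt0.
  exists r => //; exists (catan (- (x +i* y)) + pi).
  by rewrite expi_pi mulrN -h opprK.
- have [//|r r0 h] := @catanP R (x +i* y).
  by exists r => //; exists (catan (x +i* y)).
- have y0 : y != 0.
    by apply: contraNneq c0 => ->; rewrite x0.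
  exists `|y|; first by rewrite normr_gt0.
  have [y1|y1] := ltP 0 y.
    exists (pi / 2); rewrite /expi cos_pihalf sin_pihalf x0 gtr0_norm //.
    by apply/eqP; rewrite eq_complex /=; apply/andP; split; apply/eqP; ring.
  exists (pi / 2 + pi); rewrite expi_pi /expi cos_pihalf sin_pihalf x0 ler0_norm //.
  by apply/eqP; rewrite eq_complex /=; apply/andP; split; apply/eqP; ring.
Qed.

Lemma expi_neq0 (a : R) : expi a != 0.
Proof.
apply/eqP => h; have := expiD a (- a); rewrite subrr expi0 h mul0r => /eqP.
by rewrite oner_eq0.
Qed.

Lemma expiNK (a : R) : expi (- a) * expi a = 1.
Proof. by rewrite -expiD addNr expi0. Qed.

Lemma polar_unique (r r' a b : R) : 0 < r -> 0 < r' ->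
  r%:C * expi a = r'%:C * expi b -> expi a = expi b.
Proof.
move=> r0 r'0 h.
have : r%:C = r'%:C * expi (b - a).
  by rewrite expiD mulrA -h -mulrA [expi a * _]mulrC expiNK mulr1.
move=> /eqP; rewrite eq_complex /= !mul0r subr0 addr0 => /andP[/eqP h1 /eqP h2].
have s0 : sin (b - a) = 0.
  by move/esym/eqP: h2; rewrite mulf_eq0 gt_eqF //= => /eqP.
have c1 : cos (b - a) = 1.
  have := cos2Dsin2 (b - a); rewrite s0 expr0n addr0 => /eqP.
  rewrite sqrf_eq1 => /orP[/eqP//|/eqP c1].
  by move: r0; rewrite h1 c1; lra.
rewrite -[b](subrK a) expiD /expi c1 s0.
by apply/eqP; rewrite eq_complex /=; apply/andP; split; apply/eqP; ring.
Qed.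

Lemma expi_eq1 (a : R) : expi a = 1 -> `|a| <= 1 -> a = 0.
Proof.
move=> /eqP; rewrite eq_complex /= => /andP[_ /eqP s0] a1.
have pi1 : (1 : R) < pi by have := pi_ge2 R; lra.
move: a1; rewrite ler_norml => a1; have [a0|a0|//] := ltrgtP a 0.
  by have := @sin_gt0_pi R (- a); rewrite sinN s0 oppr0 ltxx; lra.
by have := @sin_gt0_pi R a; rewrite s0 ltxx; lra.
Qed.

Lemma continuous_line (V : normedModType R) (a b : V) (t : R) :
  {for t, continuous (fun t : R => (1 - t) *: a + t *: b)}.
Proof.
apply: continuousD.
  apply: continuous_scale; last exact: cst_continuous.
  by apply: continuousB => //; exact: cst_continuous.
by apply: continuous_scale => //; exact: cst_continuous.
Qed.

(** Points that are not antipodal are joined by the radial projection of a segment, along which [F]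
    can change only by multiples of 2 pi. If it changed, the intermediate value theorem would give
    it a value other than [F a] at distance at most 1 from [F a], against [expi_eq1]. Antipodal
    points are compared through a third one, available in dimension at least 2. *)
Lemma sphere_const (n : nat) (F : 'cV[R]_n.+2 -> R) :
  (forall x, `|x| = 1 -> {for x, continuous F}) ->
  (forall x y, `|x| = 1 -> `|y| = 1 -> expi (F x) = expi (F y)) ->
  forall x y, `|x| = 1 -> `|y| = 1 -> F x = F y.
Proof.
move=> cF eF.
have main a b : `|a| = 1 -> `|b| = 1 -> b != - a -> F a = F b.
  move=> a1 b1 ab; apply/eqP; apply/negPn/negP => Fab.
  pose p t : 'cV[R]_n.+2 := (1 - t) *: a + t *: b.
  have p0 t : 0 <= t <= 1 -> p t != 0.
    move=> t01; apply: contra_neq ab => pt0.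
    have e : (1 - t) *: a = - (t *: b) by apply/eqP; rewrite -addr_eq0; apply/eqP.
    (* Comparing norms in (1 - t) a = - t b gives 1 - t = t, and then b = - a. *)
    have t12 : t = 1 / 2.
      have := congr1 Num.norm e; rewrite normrN !normrZ a1 b1 !mulr1.
      by rewrite !ger0_norm; lra.
    have t0 : t != 0 by lra.
    apply: (scalerI t0); rewrite scalerN -[LHS]opprK -e.
    by rewrite (_ : 1 - t = t) //; lra.
  pose f t := F (unitize (p t)).
  have cf : {within `[0, 1], continuous f}.
    apply: continuous_in_subspaceT => t; rewrite inE /= in_itv /= => t01.
    apply: (continuous_comp (f := p) (g := fun z => F (unitize z))); first exact:
      continuous_line.
    apply: (continuous_comp (f := @unitize R _) (g := F)).
      by apply: unitize_continuous; exact: p0.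
    by apply: cF; apply: norm_unitize; exact: p0.
  have f0 : f 0 = F a.
    by rewrite /f /p subr0 scale1r scale0r addr0 unitize_id.
  have f1 : f 1 = F b.
    by rewrite /f /p subrr scale1r scale0r add0r unitize_id.
  have [v [v1 v2 v3]] : exists v, [/\ Num.min (f 0) (f 1) <= v <= Num.max (f 0) (f 1),
      v != F a & `|v - F a| <= 1].
    rewrite f0 f1; have [h|h] := ltP (F a) (F b).
      exists (Num.min (F b) (F a + 1)); case: (leP (F b) (F a + 1)) => ?.
        by split; [lra|rewrite eq_sym|rewrite ler_norml; lra].
      by split; [lra|lra|rewrite ler_norml; lra].
    have {}h : F b < F a by rewrite lt_neqAle eq_sym Fab.
    exists (Num.max (F b) (F a - 1)); case: (leP (F b) (F a - 1)) => ?.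
      by split; [lra|lra|rewrite ler_norml; lra].
    by split; [lra|rewrite eq_sym|rewrite ler_norml; lra].
  have [c c01 fc] := IVT ler01 cf v1.
  have uc : `|unitize (p c)| = 1 by apply/norm_unitize/p0; move: c01; rewrite in_itv.
  have ev : expi (v - F a) = 1.
    by rewrite expiD -fc (eF _ a uc a1) mulrC expiNK.
  by move: v2; rewrite -subr_eq0 (expi_eq1 ev v3) eqxx.
move=> x y x1 y1; have [yx|] := eqVneq y (- x); last exact: main.
pose e (i : 'I_n.+2) : 'cV[R]_n.+2 := unitize (delta_mx i 0).
have d0 (i : 'I_n.+2) : delta_mx i 0 != 0 :> 'cV[R]_n.+2.
  by apply/eqP => /matrixP/(_ i 0); rewrite !mxE !eqxx => /eqP; rewrite oner_eq0.
have e1 i : `|e i| = 1 by exact: norm_unitize.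
have [c [c1 cx cx']] : exists c, [/\ `|c| = 1, c != - x & c != x].
  pose i0 : 'I_n.+2 := ord0; pose i1 : 'I_n.+2 := lift ord0 ord0.
  have ei0 : e i1 i0 0 = 0 by rewrite !mxE /= mulr0.
  have ei00 : e i0 i0 0 != 0.
    by rewrite !mxE eqxx mulr1 invr_eq0 normr_eq0.
  have [h1|h1] := eqVneq (x i0 0) 0.
    exists (e i0); split => //; apply: contra_neq ei00 => ->;
      rewrite ?mxE h1 ?oppr0 //.
  exists (e i1); split => //; apply: contra_neq h1 => h;
    first by rewrite -[x]opprK -h mxE ei0 oppr0.
  by rewrite -h.
rewrite (main x c) // (main c y) // yx.
by apply: contra_neq cx' => /oppr_inj.
Qed.

(** [n = 1] is the punctured plane, on which [g] may wind around 0. For [n = 0] a constant argument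
    is chosen on each half-line. *)
Lemma angle (n : nat) (g : 'cV[R]_n.+1 -> C) : n != 1%N ->
  (forall x, x != 0 -> ccont g x) -> (forall x, x != 0 -> g x != 0) ->
  (forall (r : R) x, 0 < r -> x != 0 -> g (r *: x) = g x) ->
  exists a : 'cV[R]_n.+1 -> R, forall x, x != 0 ->
    {for x, continuous a} /\ exists2 r : R, 0 < r & g x = r%:C * expi (a x).
Proof.
case: n g => [|[//|n]] g _ gc g0 gh.
  have o1 := const_mx1_neq0 R 0.
  have [rp rp0 [ap gp]] := polar (g0 _ o1).
  have n1 : - const_mx 1 != 0 :> 'cV[R]_1 by rewrite oppr_eq0.
  have [rn rn0 [an gn]] := polar (g0 _ n1).
  have cx (x : 'cV[R]_1) : x = x 0 0 *: const_mx 1.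
    by apply/matrixP => i j; rewrite !ord1 !mxE mulr1.
  exists (fun x => if 0 < x 0 0 then ap else an) => x x0.
  have [x1|x1] := ltP 0 (x 0 0); split.
  - apply: (@continuous_near_eq _ _ (fun=> ap)); last exact: cst_continuous.
    have : nbhs x [set y : 'cV[R]_1 | 0 < y 0 0].
      exact: (cvgr_gt _ (@coord_continuous R 1 1 0 0 x) _ x1).
    by apply: filterS => y /= ->.
  - by exists rp => //; rewrite (cx x) gh // x1.
  - have {}x1 : x 0 0 < 0.
      rewrite lt_neqAle x1 andbT; apply: contra_neq x0 => h.
      by rewrite (cx x) h scale0r.
    apply: (@continuous_near_eq _ _ (fun=> an)); last exact: cst_continuous.
    have : nbhs x [set y : 'cV[R]_1 | y 0 0 < 0].
      exact: (cvgr_lt _ (@coord_continuous R 1 1 0 0 x) _ x1).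
    by apply: filterS => y /= yn; rewrite ltNge (ltW yn).
  - have {}x1 : x 0 0 < 0.
      rewrite lt_neqAle x1 andbT; apply: contra_neq x0 => h.
      by rewrite (cx x) h scale0r.
    exists rn => //; rewrite (cx x) -[x 0 0]opprK scaleNr -scalerN gh ?oppr_gt0
      ?oppr_eq0 //.
(* [n] now stands for the former [n - 2]: the equator lies in R^(n+2), where its sphere is
   connected, as [sphere_const] requires. *)
pose U : set 'cV[R]_n.+2 := [set y | `|y| = 1].
pose G t (y : 'cV[R]_n.+2) := g (jpath (clamp t) y).
have Gc t y : U y -> ccont (fun z : R * 'cV[R]_n.+2 => G z.1 z.2) (t, y).
  move=> y1; apply: (ccont_comp (@jpath_clamp_continuous R n.+1 (t, y))).
  by apply: gc; exact: jpath_neq0.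
have G0 t y : U y -> G t y != 0 by move=> y1; apply: g0; exact: jpath_neq0.
have [N Nh] : exists N, forall t t' y, U y -> `|t - t'| <= N.+1%:R^-1 ->
    0 < complex.Re (G t' y / G t y).
  have [||N h] := @unif_diag R n.+2 (fun t t' y => complex.Re (G t' y / G t y)).
  - move=> t t' y y1.
    have c1 : ccont (fun z : R * R * 'cV[R]_n.+2 => G z.1.2 z.2) ((t, t'), y).
      apply: (ccont_comp (f := fun z : R * 'cV[R]_n.+2 => G z.1 z.2)
        (@continuous_drop_fst _ _ _ ((t, t'), y))); exact: Gc.
    have c2 : ccont (fun z : R * R * 'cV[R]_n.+2 => G z.1.1 z.2) ((t, t'), y).
      apply: (ccont_comp (f := fun z : R * 'cV[R]_n.+2 => G z.1 z.2)
        (@continuous_drop_snd _ _ _ ((t, t'), y))); exact: Gc.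
    by apply: (ccontM c1 (ccontV _ c2)).1; exact: G0.
  - by move=> t y y1; rewrite divff ?G0.
  exists N => t t' y y1 tt'.
  have := h (clamp t) (clamp t') y y1 (clamp_itv _).
  rewrite /G !(clamp_id (clamp_itv _)); apply.
  by apply: le_trans tt'; exact: clamp_lip.
have [a [ac a0 aP]] := lift_angle Gc G0 Nh.
have GE0 y : G 0 y = g (col_mx (-1)%:M 0 : 'cV[R]_(1 + n.+2)).
  by rewrite /G clamp_id ?lexx ?ler01 // jpath0.
have GE1 y : G 1 y = g (col_mx 1%:M 0 : 'cV[R]_(1 + n.+2)).
  by rewrite /G clamp_id ?lexx ?ler01 // jpath1.
have I1 : 0 <= (1 : R) <= 1 by rewrite ler01 lexx.
have e1 := norm_const_mx1 R n.+1.
have a1 y : U y -> a 1 y = a 1 (const_mx 1).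
  move=> y1; apply: (sphere_const (F := a 1)) => //.
    move=> x x1; apply: (continuous_comp (f := fun y : 'cV[R]_n.+2 => ((1 :
      R), y)) (g := fun z => a z.1 z.2)).
      by apply: continuous_pair => //; exact: cst_continuous.
    exact: ac.
  move=> x x' x1 x'1.
  have [r r0 h] := aP 1 x x1 I1; have [r' r'0 h'] := aP 1 x' x'1 I1.
  apply: (polar_unique r0 r'0); apply: (mulfI (G0 0 x x1)).
  by rewrite !mulrA -h {1}(GE0 x) -(GE0 x') -h' !GE1.
have [r0 r00 [a00 ga]] := polar (G0 0 _ e1).
exists (fun x => a00 + a (jt x) (jy x)) => x x0; split.
  apply: continuousD; first exact: cst_continuous.
  by apply: pole_glue x0; [exact: ac | exact: a0 | exact: a1].
have [r r1 h] := aP (jt x) (jy x) (norm_jy x) (jt_itv x0).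
exists (r0 * r); first exact: mulr_gt0.
have -> : g x = G (jt x) (jy x).
  rewrite /G clamp_id ?jt_itv // jpath_jt // gh //.
  by rewrite invr_gt0 join_norm_gt0.
rewrite h GE0 -(GE0 (const_mx 1)) ga expiD (rmorphM (real_complex R)) /=.
by rewrite -!mulrA; congr (_ * _); rewrite mulrCA.
Qed.
End Angle.

(** * A continuous section of a line field when d is not 3 *)

Section ContinuousSection.
Variable R : realType.
Local Notation C := R[i].

Definition is_lproj (m : nat) (Q : 'M[C]_m) := exists2 v :
  'cV[C]_m, v != 0 & Q = lproj v.

Lemma is_lproj_idem m (Q : 'M[C]_m) : is_lproj Q -> Q *m Q = Q.
Proof.
move=> [v v0 ->]; rewrite {2}/lproj -scalemxAr mulmxA lproj_id.
by rewrite /lproj.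
Qed.

Lemma is_lproj_trace m (Q : 'M[C]_m) : is_lproj Q -> \tr Q = 1.
Proof.
move=> [v v0 ->]; rewrite /lproj linearZ /= mxtrace_mulC /mxtrace big_ord1.
by rewrite mulVf // hdot_eq0.
Qed.

Lemma is_lproj_range m (Q : 'M[C]_m) (w : 'cV[C]_m) :
  is_lproj Q -> w != 0 -> Q *m w = w -> Q = lproj w.
Proof.
move=> [v v0 ->] w0; rewrite lprojE; set c := _ / _ => cv.
rewrite -cv lprojZ //; apply: contra_neq w0 => c0.
by rewrite -cv c0 scale0r.
Qed.

(** The trace of a product of two such projections is the squared cosine of the angle between the
    lines. It is 1 for [t = t'], and as long as it is positive the lines are not orthogonal, which
    is what [lift_line] asks of a step. *)
Lemma lift_sphere (n m : nat) (Q : R -> 'cV[R]_n -> 'M[C]_m) (v0 :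
  'cV[R]_n -> 'cV[C]_m) :
  (forall t x, `|x| = 1 -> mcont (fun z : R * 'cV[R]_n => Q z.1 z.2) (t, x)) ->
  (forall t x, `|x| = 1 -> is_lproj (Q t x)) ->
  (forall x, `|x| = 1 -> mcont v0 x) ->
  (forall x, `|x| = 1 -> v0 x != 0 /\ Q 0 x *m v0 x = v0 x) ->
  exists V : R -> 'cV[R]_n -> 'cV[C]_m,
    [/\ forall t x, `|x| = 1 -> mcont (fun z : R * 'cV[R]_n => V z.1 z.2) (t, x),
        forall x, `|x| = 1 -> V 0 x = v0 x &
        forall t x, `|x| = 1 -> 0 <= t <= 1 -> V t x != 0 /\ Q t x *m V t x = V t x].
Proof.
move=> Qc Qp v0c v0P.
have [||N h] := @unif_diag R n (fun t t' x => complex.Re (\tr (Q t' x *m Q t x))).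
- move=> t t' x x1.
  have c1 : mcont (fun z : R * R * 'cV[R]_n => Q z.1.2 z.2) ((t, t'), x).
    apply: (mcont_comp (F := fun z : R * 'cV[R]_n => Q z.1 z.2)
      (@continuous_drop_fst _ _ _ ((t, t'), x))); exact: Qc.
  have c2 : mcont (fun z : R * R * 'cV[R]_n => Q z.1.1 z.2) ((t, t'), x).
    apply: (mcont_comp (F := fun z : R * 'cV[R]_n => Q z.1 z.2)
      (@continuous_drop_snd _ _ _ ((t, t'), x))); exact: Qc.
  have c3 := mcontM c1 c2.
  suff [] : ccont (fun z : R * R * 'cV[R]_n =>
    \tr (Q z.1.2 z.2 *m Q z.1.1 z.2)) ((t, t'), x) by [].
  by rewrite /mxtrace; apply: ccont_sum => i _; exact: c3.
- by move=> t x x1; rewrite is_lproj_idem ?is_lproj_trace //; exact: Qp.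
apply: (@lift_line R _ [set x : 'cV[R]_n | `|x| = 1] m Q v0 N) => //.
  by move=> t x w x1; rewrite mulmxA is_lproj_idem //; exact: Qp.
move=> t t' x w x1 t01 t'01 tt' Qw w0; have := h t t' x x1 t01 tt'.
rewrite (is_lproj_range (Qp t x x1) w0 Qw) {1}/lproj -scalemxAr mulmxA.
by apply: contraTneq => ->; rewrite mul0mx scaler0 mxtrace0 ltxx.
Qed.

(** Here d = n + 2 and the equator is a sphere of dimension n, so [n = 1] is the case d = 3. *)
Lemma join_section (n m : nat) (E : 'cV[R]_(1 + n.+1) -> 'M[C]_m) : n != 1%N ->
  (forall x, x != 0 -> mcont E x) ->
  (forall x, x != 0 -> is_lproj (E x)) ->
  (forall (r : R) x, 0 < r -> x != 0 -> E (r *: x) = E x) ->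
  exists W : 'cV[R]_(1 + n.+1) -> 'cV[C]_m,
    forall x, x != 0 -> [/\ mcont W x, W x != 0 & E x *m W x = W x].
Proof.
move=> n1 Ec Ep Eh.
pose Q t (y : 'cV[R]_n.+1) := E (jpath (clamp t) y).
have Qc t y : `|y| = 1 -> mcont (fun z : R * 'cV[R]_n.+1 => Q z.1 z.2) (t, y).
  move=> y1; apply: (mcont_comp (@jpath_clamp_continuous R n (t, y))).
  by apply: Ec; exact: jpath_neq0.
have Qp t y : `|y| = 1 -> is_lproj (Q t y).
  by move=> y1; apply/Ep/jpath_neq0.
have e1 := norm_const_mx1 R n.
have Q0 y : Q 0 y = Q 0 (const_mx 1) by rewrite /Q clamp_id ?lexx ?ler01 // !jpath0.
have Q1 y : Q 1 y = Q 1 (const_mx 1) by rewrite /Q clamp_id ?lexx ?ler01 // !jpath1.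
have I0 : 0 <= (0 : R) <= 1 by rewrite ler01 lexx.
have I1 : 0 <= (1 : R) <= 1 by rewrite ler01 lexx.
have [c c0 Q0c] := Qp 0 _ e1.
have [c' c'0 Q1c] := Qp 1 _ e1.
have [|x x1|V [Vc V0 VP]] := lift_sphere (v0 := fun=> c) Qc Qp.
- by move=> x _; exact: mcont_cst.
- by rewrite Q0 Q0c lproj_id.
(* The clutching function: the coordinate of the lifted vector at the north pole along the fixed
   generator [c']. *)
pose g0 y := hdot c' (V 1 y) / hdot c' c'.
have V1 y : `|y| = 1 -> V 1 y = g0 y *: c'.
  by move=> y1; have [_ h] := VP 1 y y1 I1; rewrite -[LHS]h Q1 Q1c lprojE.
have g00 y : `|y| = 1 -> g0 y != 0.
  move=> y1; have [] := VP 1 y y1 I1; rewrite V1 // => h _.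
  by apply: contra_neq h => ->; rewrite scale0r.
have g0c y : `|y| = 1 -> ccont g0 y.
  move=> y1; apply: ccontM; last exact: ccont_cst.
  have c1 : mcont (V 1) y.
    apply: (mcont_comp (F := fun z : R * 'cV[R]_n.+1 => V z.1 z.2)
      (g := fun y : 'cV[R]_n.+1 => ((1 : R), y))); last exact: Vc.
    by apply: continuous_pair => //; exact: cst_continuous.
  exact: (mcontM (@mcont_cst R _ _ _ (c'^t*) y) c1).
have [|||a aP] := @angle R n (fun x => g0 (unitize x)) n1.
- move=> x x0; apply: ccont_comp; first exact: unitize_continuous.
  exact/g0c/norm_unitize.
- by move=> x x0; exact/g00/norm_unitize.
- move=> r x r0 x0; congr g0; rewrite /unitize normrZ gtr0_norm // scalerA.
  by rewrite invfM mulrAC mulVf ?mul1r // gt_eqF.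
(* Rotating V t y by the angle - t a(y) makes it constant at the north pole. *)
pose rho y := complex.Re (g0 y * expi (- a y)).
(* The real factor goes from 1 to 1 / rho(y) through positive values, so that the modulus becomes
   independent of y as well. *)
pose F t y := ((1 - t) + t / rho y)%:C * expi (- (t * a y)) *: V t y.
have rhoP y : `|y| = 1 -> 0 < rho y /\ g0 y = (rho y)%:C * expi (a y).
  move=> y1; have [_ [r r0]] := aP y (norm1_neq0 y1); rewrite unitize_id // => h.
  have -> : rho y = r by rewrite /rho h -mulrA [expi _ * _]mulrC expiNK mulr1.
  by [].
have Fc t y : `|y| = 1 -> mcont (fun z : R * 'cV[R]_n.+1 => F z.1 z.2) (t, y).
  move=> y1; have y0 := norm1_neq0 y1.
  have cs : {for (t, y), continuous (fun z : R * 'cV[R]_n.+1 => z.2)} by exact: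
    continuous_snd.
  have cf : {for (t, y), continuous (fun z : R * 'cV[R]_n.+1 => z.1)} by exact:
    continuous_fst.
  have ca : {for y, continuous a} := (aP y y0).1.
  have ca' : {for (t, y), continuous (fun z : R * 'cV[R]_n.+1 => a z.2)}.
    exact: (continuous_comp (f := snd) (g := a)).
  have expic (T : topologicalType) (f : T -> R) (x : T) : {for x, continuous f} ->
      ccont (fun z => expi (- f z)) x.
    move=> cf'; have cN : {for x, continuous (fun z => - f z)} by exact: continuousN.
    split; first by apply: (continuous_comp cN); exact: continuous_cos.
    by apply: (continuous_comp cN); exact: continuous_sin.
  apply: mcontZ; last exact: Vc.
  apply: ccontM; last by apply: expic; exact: continuousM.
  apply: ccont_real; apply: continuousD.
    by apply: continuousB => //; exact: cst_continuous.
  apply: continuousM => //; apply: continuousV; first by rewrite gt_eqF //; exact: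
    (rhoP y y1).1.
  apply: (continuous_comp (f := snd) (g := rho)) => //.
  suff [] : ccont (fun y => g0 y * expi (- a y)) y by [].
  by apply: ccontM; [exact: g0c | exact: expic].
have F0 y : `|y| = 1 -> F 0 y = c.
  by move=> y1; rewrite /F subr0 !mul0r addr0 oppr0 expi0 mulr1 scale1r V0.
have F1 y : `|y| = 1 -> F 1 y = c'.
  move=> y1; rewrite /F subrr add0r !mul1r V1 // scalerA.
  have [r0 h] := rhoP y y1; rewrite [X in _ * X]h.
  rewrite mulrACA -(rmorphM (real_complex R)) mulVf ?gt_eqF // rmorph1 mul1r expiNK.
  by rewrite scale1r.
exists (fun x => F (jt x) (jy x)) => x x0; split.
- move=> i j; split.
    apply: (@pole_glue R n (fun t y => complex.Re (F t y i j)) (complex.Re (c i j))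
      (complex.Re (c' i j))) => //.
    + by move=> t y y1; have [] := Fc t y y1 i j.
    + by move=> y y1; rewrite F0.
    + by move=> y y1; rewrite F1.
  apply: (@pole_glue R n (fun t y => complex.Im (F t y i j)) (complex.Im (c i j))
    (complex.Im (c' i j))) => //.
  + by move=> t y y1; have [] := Fc t y y1 i j.
  + by move=> y y1; rewrite F0.
  + by move=> y y1; rewrite F1.
- have [Vn _] := VP (jt x) (jy x) (norm_jy x) (jt_itv x0).
  rewrite scaler_eq0 negb_or Vn andbT mulf_neq0 ?expi_neq0 //.
  have [r0 _] := rhoP (jy x) (norm_jy x).
  have /andP[t0 t1] := jt_itv x0.
  rewrite (_ : 0 = (0 : R)%:C) // (inj_eq (@complexI R)) gt_eqF //.
  have [t1'|t1'] := ltP (jt x) 1.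
    by rewrite ltr_pwDl ?subr_gt0 // divr_ge0 // ltW.
  by rewrite (_ : jt x = 1) ?subrr ?add0r ?divr_gt0 //; lra.
- have [_ h] := VP (jt x) (jy x) (norm_jy x) (jt_itv x0).
  rewrite -scalemxAr; congr (_ *: _); rewrite -[RHS]h; congr (_ *m _).
  rewrite /Q clamp_id ?jt_itv // jpath_jt // Eh // invr_gt0.
  exact: join_norm_gt0.
Qed.
End ContinuousSection.

(** * The topology of the projective space *)

Section ProjectiveContinuity.
Variable R : realType.
Local Notation C := R[i].

Lemma Re_continuous : continuous (fun z : R[i]^o => complex.Re z).
Proof.
move=> z; apply/continuous_dist => e e0.
have e0' : (0 : C) < e%:C by rewrite ltcR.
have : nbhs z [set w : R[i]^o | `|z - w| < e%:C].
  by apply/nbhs_ballP; exists (e%:C) => // w.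
apply: filterS => w /= h; rewrite -ltcR.
apply: le_lt_trans h; rewrite (_ : complex.Re z - complex.Re w = complex.Re (z - w)).
  exact: normc_ge_Re.
by case: z w => ? ? [].
Qed.

Lemma Im_continuous : continuous (fun z : R[i]^o => complex.Im z).
Proof.
move=> z; apply/continuous_dist => e e0.
have e0' : (0 : C) < e%:C by rewrite ltcR.
have : nbhs z [set w : R[i]^o | `|z - w| < e%:C].
  by apply/nbhs_ballP; exists (e%:C) => // w.
apply: filterS => w /= h; rewrite -ltcR.
apply: le_lt_trans h; rewrite (_ : complex.Im z - complex.Im w = complex.Im (z - w)).
  by rewrite normc_def lecR -sqrtr_sqr ler_wsqrtr // lerDr sqr_ge0.
by case: z w => ? ? [].
Qed.

(** The projective space takes its topology from the norm of [R[i]^o], whereas continuity is handled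
    here by real and imaginary parts; |z| <= |Re z| + |Im z| leads from the latter to the former. *)
Lemma ccont_continuous (T : topologicalType) (f : T -> C) x : ccont f x ->
  {for x, continuous (f : T -> R[i]^o)}.
Proof.
move=> [f1 f2]; apply/cvgrPdist_lt => e e0.
have [r r0 er] : exists2 r : R, 0 < r & e = r%:C.
  move: e e0 => [a b]; rewrite ltcE /= => /andP[/eqP b0 a0]; exists a => //.
  by rewrite b0.
have r2 : 0 < r / 2 by rewrite divr_gt0.
have n1 := (continuous_dist _ _).1 f1 _ r2.
have n2 := (continuous_dist _ _).1 f2 _ r2.
apply: filterS2 n1 n2 => y h1 h2.
rewrite er; case: (f x) (f y) h1 h2 => a b [c d] /= h1 h2.
have -> : (a +i* b) - (c +i* d) = (a - c) +i* (b - d) by [].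
rewrite /Num.norm /= ltcR.
apply: (@le_lt_trans _ _ (`|a - c| + `|b - d|)).
  have -> : `|a - c| + `|b - d| = Num.sqrt ((`|a - c| + `|b - d|) ^+ 2).
    by rewrite sqrtr_sqr [RHS]ger0_norm ?addr_ge0.
  apply: ler_wsqrtr; rewrite [leRHS]sqrrD !real_normK ?num_real //.
  by rewrite -subr_ge0; have := normr_ge0 (a-c); have := normr_ge0 (b-d); nra.
by rewrite (splitr r); exact: ltrD.
Qed.

Variable m : nat.
Local Notation CP := (projective_space R m).

Lemma line_gen (L : CP) : exists2 v : 'cV[C]_m, v != 0 & line L = <[v]>%VS.
Proof.
exists (vpick (line L)).
  by rewrite vpick0 -dimv_eq0 (eqP (line_dim L)).
apply/esym/eqP; rewrite eqEdim (eqP (line_dim L)) dim_vline vpick0 -dimv_eq0.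
by rewrite (eqP (line_dim L)) andbT -memvE memv_pick.
Qed.

(** The usual embedding of CP^(m-1) into the matrices; by [cprojE] the chosen generator does not
    matter. *)
Definition cproj (L : CP) : 'M[C]_m := lproj (s2val (cid2 (line_gen L))).

Lemma cproj_gen (L : CP) : exists v : 'cV[C]_m,
  [/\ v != 0, line L = <[v]>%VS & cproj L = lproj v].
Proof.
exists (s2val (cid2 (line_gen L))); split => //; rewrite /s2val.
  by case: (cid2 (line_gen L)).
by case: (cid2 (line_gen L)).
Qed.

Lemma cprojE L v : v != 0 -> v \in line L -> cproj L = lproj v.
Proof.
move=> v0; have [w [w0 -> ->]] := cproj_gen L; move=> /vlineP[k kE].
by rewrite kE lprojZ //; apply: contra_neq v0 => h; rewrite kE h scale0r.
Qed.

Lemma cproj_lproj L : is_lproj (cproj L).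
Proof. by have [w [w0 _ ->]] := cproj_gen L; exists w. Qed.

Lemma coordc_continuous (v : 'cV[R[i]^o]_m) : mcont (fun w : 'cV[R[i]^o]_m => (w :
  'cV[C]_m)) v.
Proof.
move=> i j; split.
  apply: (continuous_comp (g := fun z : R[i]^o => complex.Re z)).
    exact: (@coord_continuous R[i] m 1 i j).
  exact: Re_continuous.
apply: (continuous_comp (g := fun z : R[i]^o => complex.Im z)).
  exact: (@coord_continuous R[i] m 1 i j).
exact: Im_continuous.
Qed.

Lemma projective_openE (U : set CP) : open U = projective_open U.
Proof. by []. Qed.

(** The universal property of the quotient topology, for real functions. *)
Lemma projective_continuous (f : CP -> R) (F : 'cV[R[i]^o]_m -> R) :
  (forall v, v != 0 -> {for v, continuous F}) ->
  (forall L v, v != 0 -> line L = <[v]>%VS -> f L = F v) -> continuous f.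
Proof.
move=> cF fF; apply/continuousP => O oO.
rewrite projective_openE /projective_open openE => v [v0 [L OL Lv]].
have Fv : O (F v) by rewrite -(fF L).
have n1 : nbhs v [set w | O (F w)].
  by apply: (cF v v0); exact: open_nbhs_nbhs.
have n2 : nbhs v [set w : 'cV[R[i]^o]_m | w != 0].
  apply: open_nbhs_nbhs; split => //.
  have := @projective_openT R m; rewrite /projective_open.
  rewrite (_ : projective_preimage _ = [set w | w != 0]) //.
  apply/seteqP; split=> [w []//|w w0]; split => //.
  have dw : \dim <[w : 'cV[C]_m]>%VS == 1%N by rewrite dim_vline w0.
  by exists (ProjectiveLine dw).
rewrite /interior; apply: filterS2 n1 n2 => w /= Fw w0; split => //.
have dw : \dim <[w : 'cV[C]_m]>%VS == 1%N by rewrite dim_vline w0.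
by exists (ProjectiveLine dw) => //=; rewrite (fF _ w).
Qed.

Lemma cproj_continuous L : mcont cproj L.
Proof.
have key (v : 'cV[R[i]^o]_m) : v != 0 -> mcont (fun w : 'cV[R[i]^o]_m => lproj (w :
  'cV[C]_m)) v.
  by move=> v0; apply: mcont_lproj => //; exact: coordc_continuous.
move=> i j; split.
  apply: (@projective_continuous _ (fun v => complex.Re (lproj (v : 'cV[C]_m) i j))).
    by move=> v v0; have [] := key v v0 i j.
  by move=> L' v v0 L'v; rewrite (cprojE (v := v)) // L'v memv_line.
apply: (@projective_continuous _ (fun v => complex.Im (lproj (v : 'cV[C]_m) i j))).
  by move=> v v0; have [] := key v v0 i j.
by move=> L' v v0 L'v; rewrite (cprojE (v := v)) // L'v memv_line.
Qed.

(** Near [x] the vector [G] does not vanish, and [H] is the composite of [G] with the quotient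
    map. *)
Lemma continuous_into_projective (T : topologicalType) (G : T -> 'cV[C]_m) (H :
  T -> CP) x :
  mcont G x -> G x != 0 -> (forall y, G y != 0 -> line (H y) = <[G y]>%VS) ->
  {for x, continuous H}.
Proof.
move=> cG Gx HG U nU.
have [W [[oW Wx] WU]] : exists W, open_nbhs (H x) W /\ W `<=` U.
  by move: nU; rewrite nbhsE => -[W ? ?]; exists W.
have cG' : {for x, continuous (G : T -> 'cV[R[i]^o]_m)}.
  by apply: (@continuous_mx R[i]) => i j; exact/ccont_continuous/cG.
have nG : nbhs x ((G : T -> 'cV[R[i]^o]_m) @^-1` projective_preimage W).
  apply: cG'; apply: open_nbhs_nbhs; split; first exact: oW.
  by split => //; exists (H x) => //; exact: HG.
apply: filterS nG => y [Gy [L WL LG]]; apply: WU.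
by rewrite (_ : H y = L) //; apply: val_inj; rewrite /= HG.
Qed.

End ProjectiveContinuity.

(** * Smooth functions *)

Section Smooth.
Variable R : realType.

Lemma diff_near_eq (V W : normedModType R) (f g : V -> W) (x : V) :
  (\forall y \near x, f y = g y) -> differentiable f x ->
  differentiable g x /\ 'd g x = 'd f x :> (V -> W).
Proof.
move=> fg /diff_locallyP[c e].
have gx : g x = f x by rewrite (nbhs_singleton fg).
have e' : g \o shift x = cst (g x) + 'd f x +o_ 0 id.
  apply/eqaddoP => eps eps0; have := (eqaddoP _ _ _ _).1 e eps eps0.
  have fg' : \forall y \near (0 : V), f (y + x) = g (y + x).
    by move: fg; rewrite (near_shift 0) subr0 /=.
  by apply: filterS2 fg' => y h; rewrite /= !fctE /= h gx.
have de := diff_unique c e'; split; last exact: de.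
by apply/diff_locallyP; rewrite de.
Qed.

Section Ck.
Variables (E : normedModType R) (U : set E).
Hypothesis oU : open U.
Implicit Types f g : E -> R.

Lemma near_open x : U x -> \forall y \near x, U y.
Proof. by move=> Ux; apply: open_nbhs_nbhs. Qed.

Lemma Ck_eq (W : normedModType R) k (f g : E -> W) :
  (forall x, U x -> f x = g x) -> Ck_on k U f -> Ck_on k U g.
Proof.
elim: k f g => [|k IH] f g fg /=.
  move=> cf x Ux U' nU'; have nfg : \forall y \near x, f y = g y.
    by apply: filterS (near_open Ux) => y; exact: fg.
  have := cf x Ux U'; rewrite fg // => /(_ nU').
  by apply: filterS2 nfg => y /= ->.
have nfg x : U x -> \forall y \near x, f y = g y.
  by move=> Ux; apply: filterS (near_open Ux) => y; exact: fg.
move=> [df cf]; split=> [x Ux|e].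
  exact: (diff_near_eq (nfg x Ux) (df x Ux)).1.
apply: IH (cf e) => x Ux; apply: near_eq_derive; exact: nfg.
Qed.

Lemma Ck_le (W : normedModType R) k (f : E -> W) : Ck_on k.+1 U f -> Ck_on k U f.
Proof.
elim: k f => [|k IH] f.
  by move=> [df _] x Ux; exact/differentiable_continuous/df.
by move=> [df cf]; split => // e; exact: IH.
Qed.

Lemma Ck_cst (W : normedModType R) k (c : W) : Ck_on k U (fun=> c).
Proof.
elim: k c => [|k IH] c /=; first by move=> x _; exact: cst_continuous.
split=> [x _|e]; first exact: differentiable_cst.
by rewrite (_ : 'D_e _ = fun=> 0) //; apply/funext => x; exact: derive_cst.
Qed.

Lemma Ck_add k f g : Ck_on k U f -> Ck_on k U g -> Ck_on k U (fun x => f x + g x).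
Proof.
elim: k f g => [|k IH] f g.
  by move=> cf cg x Ux; apply: continuousD; [exact: cf | exact: cg].
move=> [df cf] [dg cg]; split=> [x Ux|e].
  by apply: differentiableD; [exact: df | exact: dg].
apply: Ck_eq (IH _ _ (cf e) (cg e)) => x Ux.
by rewrite [RHS]deriveD //; apply: diff_derivable; [exact: df | exact: dg].
Qed.

Lemma Ck_mul k f g : Ck_on k U f -> Ck_on k U g -> Ck_on k U (fun x => f x * g x).
Proof.
elim: k f g => [|k IH] f g.
  by move=> cf cg x Ux; apply: continuousM; [exact: cf | exact: cg].
move=> hf hg; have [df cf] := hf; have [dg cg] := hg; split=> [x Ux|e].
  exact: differentiableM (df x Ux) (dg x Ux).
apply: (@Ck_eq _ _ (fun x => f x * 'D_e g x + g x * 'D_e f x)).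
  by move=> x Ux; rewrite [RHS]deriveM //; apply: diff_derivable; [exact: df |
    exact: dg].
exact: Ck_add (IH _ _ (Ck_le hf) (cg e)) (IH _ _ (Ck_le hg) (cf e)).
Qed.

Lemma Ck_inv k f : (forall x, U x -> f x != 0) -> Ck_on k U f ->
  Ck_on k U (fun x => (f x)^-1).
Proof.
move=> f0; elim: k => [|k IH].
  by move=> cf x Ux; apply: continuousV; [exact: f0 | exact: cf].
move=> hf; have [df cf] := hf; split=> [x Ux|e].
  exact: differentiableV (df x Ux) (f0 x Ux).
apply: (@Ck_eq _ _ (fun x => (-1) * ((f x)^-1 * (f x)^-1) * 'D_e f x)).
  move=> x Ux; rewrite [RHS]deriveV ?f0 //; last by apply: diff_derivable; exact: df.
  by rewrite /GRing.scale /= mulN1r -invfM -expr2.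
have hi := IH (Ck_le hf).
by apply: Ck_mul; [apply: Ck_mul; [exact: Ck_cst | exact: Ck_mul] | exact: cf].
Qed.

Lemma Ck_sqrt k f : (forall x, U x -> 0 < f x) -> Ck_on k U f ->
  Ck_on k U (fun x => Num.sqrt (f x)).
Proof.
move=> f0; elim: k => [|k IH].
  by move=> cf x Ux; apply: (continuous_comp (cf x Ux)); exact: sqrt_continuous.
move=> hf; have [df cf] := hf.
have ds (y : R) : 0 < y -> differentiable (Num.sqrt : R -> R) y.
  by move=> y0; apply/derivable1_diffP; have [] := is_derive1_sqrt y0.
split=> [x Ux|e].
  exact: differentiable_comp (df x Ux) (ds _ (f0 x Ux)).
apply: (@Ck_eq _ _ (fun x => (2 * Num.sqrt (f x))^-1 * 'D_e f x)).
  move=> x Ux; have dfx := df x Ux; have dsx := ds _ (f0 x Ux).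
  rewrite [RHS]deriveE; last exact: differentiable_comp.
  rewrite diff_comp // /= deriv1E; last exact/derivable1_diffP.
  rewrite derive1E derive_sqrt ?f0 // -deriveE //.
  by rewrite /GRing.scale /= mulrC.
apply: Ck_mul; last exact: cf.
apply: Ck_inv; first by move=> x Ux; rewrite mulf_neq0 // gt_eqF // sqrtr_gt0 f0.
by apply: Ck_mul; [exact: Ck_cst | exact/IH/Ck_le].
Qed.

End Ck.

Lemma smooth_sum (E : normedModType R) (U : set E) (I : Type) (r : seq I)
    (F : I -> E -> R) : open U ->
  (forall i, smooth_on U (F i)) -> smooth_on U (fun x => \sum_(i <- r) F i x).
Proof.
move=> oU sF k; elim: r => [|i r IH].
  rewrite (_ : (fun x => _) = fun=> 0); first exact: Ck_cst.
  by apply/funext => x; rewrite big_nil.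
rewrite (_ : (fun x => _) = fun x => F i x + \sum_(i <- r) F i x).
  by apply: (Ck_add oU) => //; exact: sF.
by apply/funext => x; rewrite big_cons.
Qed.

Lemma smooth_exp (E : normedModType R) (U : set E) (f : E -> R) (N : nat) :
  open U -> smooth_on U f -> smooth_on U (fun x => f x ^+ N).
Proof.
move=> oU sf k; elim: N => [|N IH]; first exact: Ck_cst.
rewrite (_ : (fun x => _) = fun x => f x * f x ^+ N).
  by apply: (Ck_mul oU) => //; exact: sf.
by apply/funext => x; rewrite exprS.
Qed.

Lemma smooth_coord (n : nat) (U : set 'cV[R]_n) i : open U ->
  smooth_on U (fun x : 'cV[R]_n => x i 0).
Proof.
move=> oU [|k] /=; first by move=> x _; exact: coord_continuous.
split=> [x _|e]; first exact: differentiable_coord.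
apply: (@Ck_eq _ _ oU _ _ (fun=> e i 0)); last exact: Ck_cst.
move=> x _; rewrite deriveE; last exact: differentiable_coord.
have lin : linear (fun x : 'cV[R]_n => x i 0 : R) by move=> a u v; rewrite !mxE.
pose L : {linear 'cV[R]_n -> R} := HB.pack (fun x : 'cV[R]_n => x i 0 : R)
  (GRing.isLinear.Build _ _ _ _ _ lin).
rewrite -[fun x : 'cV[R]_n => _]/(L : _ -> _) diff_lin //.
exact: coord_continuous.
Qed.

(** The derivative of a slice along [e] is the slice of the derivative along [(0, e)], which feeds
    the induction. This is how smoothness on T*M passes to one fibre. *)
Lemma smooth_slice (E1 E2 W : normedModType R) (U : set (E1 * E2)) (y : E1)
    (f : E1 * E2 -> W) : open [set z | U (y, z)] ->
  smooth_on U f -> smooth_on [set z | U (y, z)] (fun z => f (y, z)).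
Proof.
move=> oU sf k; move: (sf k) => {sf}; elim: k f => [|k IH] f /=.
  move=> cf z Uz; apply: (continuous_comp (f := fun z => (y, z)) (g := f));
    last exact: cf.
  by apply: cvg_pair; [exact: cvg_cst | exact: cvg_id].
have dp z : is_diff z (fun z : E2 => (y, z)) (fun h => (0, h)).
  exact: (is_diff_pair (is_diff_cst y z) (is_diff_id z)).
have dd z : differentiable (fun z : E2 => (y, z)) z by have [] := dp z.
move=> [df cf]; have dc z : U (y, z) -> differentiable (f \o (fun z : E2 =>
  (y, z))) z.
  by move=> Uz; exact: (differentiable_comp (dd z) (df _ Uz)).
split=> [z Uz|e]; first exact: dc.
apply: (@Ck_eq _ _ oU _ _ (fun z => 'D_((0, e) : E1 * E2) f (y, z))); last exact:
  (IH _ (cf _)).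
move=> z Uz; rewrite deriveE; last exact: df.
rewrite [RHS]deriveE; last exact: dc.
rewrite (@diff_comp _ _ _ _ (fun z => (y, z)) f z) //; last exact: df.
by rewrite /= diff_val.
Qed.

End Smooth.

(** * Smooth complex functions, determinants and adjugates *)

Section CSmooth.
Variable R : realType.
Local Notation C := R[i].
Variables (E : normedModType R) (U : set E).
Hypothesis oU : open U.

Lemma csmooth_cst (c : C) : csmooth_on U (fun=> c).
Proof. by split=> k; exact: Ck_cst. Qed.

Lemma csmooth_real (r : E -> R) : smooth_on U r -> csmooth_on U (fun x => (r x)%:C).
Proof. by move=> sr; split=> //= k; exact: Ck_cst. Qed.

Lemma csmooth_add (f g : E -> C) : csmooth_on U f -> csmooth_on U g ->
  csmooth_on U (fun x => f x + g x).
Proof.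
move=> [f1 f2] [g1 g2]; split=> k.
  rewrite (_ : (fun x => _) = fun x => complex.Re (f x) + complex.Re (g x)).
    exact: Ck_add.
  by apply/funext => x; case: (f x) (g x) => ? ? [].
rewrite (_ : (fun x => _) = fun x => complex.Im (f x) + complex.Im (g x)).
  exact: Ck_add.
by apply/funext => x; case: (f x) (g x) => ? ? [].
Qed.

Lemma csmooth_mul (f g : E -> C) : csmooth_on U f -> csmooth_on U g ->
  csmooth_on U (fun x => f x * g x).
Proof.
move=> [f1 f2] [g1 g2]; split=> k.
  rewrite (_ : (fun x => _) = fun x => complex.Re (f x) * complex.Re (g x) +
    (-1) * (complex.Im (f x) * complex.Im (g x))).
    by apply: Ck_add => //; [|apply: Ck_mul => //; [exact: Ck_cst|]]; exact: Ck_mul.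
  by apply/funext => x; case: (f x) (g x) => ? ? [? ?] /=; ring.
rewrite (_ : (fun x => _) = fun x => complex.Re (f x) * complex.Im (g x) +
    complex.Im (f x) * complex.Re (g x)).
  by apply: Ck_add => //; exact: Ck_mul.
by apply/funext => x; case: (f x) (g x) => ? ? [].
Qed.

Lemma csmooth_sum (I : Type) (r : seq I) (P : pred I) (F : I -> E -> C) :
  (forall i, P i -> csmooth_on U (F i)) ->
  csmooth_on U (fun x => \sum_(i <- r | P i) F i x).
Proof.
move=> sF; elim: r => [|i r IH].
  rewrite (_ : (fun x => _) = fun=> 0); first exact: csmooth_cst.
  by apply/funext => x; rewrite big_nil.
rewrite (_ : (fun x => _) = fun x => (if P i then F i x else 0) +
  \sum_(i <- r | P i) F i x); last first.
  by apply/funext => x; rewrite big_cons; case: ifP => //; rewrite add0r.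
apply: csmooth_add => //; case Pi : (P i); [exact: sF | exact: csmooth_cst].
Qed.

Lemma csmooth_prod (I : Type) (r : seq I) (F : I -> E -> C) :
  (forall i, csmooth_on U (F i)) ->
  csmooth_on U (fun x => \prod_(i <- r) F i x).
Proof.
move=> sF; elim: r => [|i r IH].
  rewrite (_ : (fun x => _) = fun=> 1); first exact: csmooth_cst.
  by apply/funext => x; rewrite big_nil.
rewrite (_ : (fun x => _) = fun x => F i x * \prod_(i <- r) F i x).
  exact: csmooth_mul.
by apply/funext => x; rewrite big_cons.
Qed.

Lemma csmooth_det (n : nat) (F : E -> 'M[C]_n) :
  (forall i j, csmooth_on U (fun x => F x i j)) -> csmooth_on U (fun x => \det (F x)).
Proof.
move=> sF; rewrite /determinant.
apply: (csmooth_sum _ (F := fun (s : {perm 'I_n}) x =>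
  (-1) ^+ s * \prod_i F x i (s i))) => s _.
apply: (csmooth_mul (f := fun=> (-1) ^+ s)); first exact: csmooth_cst.
by apply: (csmooth_prod _ (F := fun i x => F x i (s i))).
Qed.

Lemma csmooth_adj (n : nat) (F : E -> 'M[C]_n) :
  (forall i j, csmooth_on U (fun x => F x i j)) ->
  forall i j, csmooth_on U (fun x => (\adj (F x)) i j).
Proof.
move=> sF i j.
rewrite (_ : (fun x => _) = fun x => (-1) ^+ (j + i) * \det (row' j (col' i (F x)))).
  apply: csmooth_mul; first exact: csmooth_cst.
  apply: csmooth_det => k l.
  by rewrite (_ : (fun x => _) = fun x => F x (lift j k) (lift i l)) //;
    apply/funext => x; rewrite !mxE.
by apply/funext => x; rewrite mxE.
Qed.

Lemma csmooth_ccont (f : E -> C) x : U x -> csmooth_on U f -> ccont f x.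
Proof. by move=> Ux [f1 f2]; split; [exact: (f1 0%N) | exact: (f2 0%N)]. Qed.

End CSmooth.

(** * Smooth eigenprojections *)

Section Adjugate.
Variables (R : realType) (m : nat).
Local Notation C := R[i].

Lemma hdot_mulmx (N : 'M[C]_m) (v w : 'cV[C]_m) : N^t* = N ->
  hdot v (N *m w) = hdot (N *m v) w.
Proof.
by move=> hN; rewrite /hdot mulmxA; congr ((_ *m _) 0 0);
  rewrite -[N in LHS]hN trmx_mul map_mxM.
Qed.

(* Replace row i0 of N, with v i0 != 0, by v^*: the kernel becomes trivial, so the
   new determinant, expanded along that row, exhibits a nonzero minor of N. *)
Lemma adj_neq0 (N : 'M[C]_m) (v : 'cV[C]_m) : N^t* = N -> v != 0 -> N *m v = 0 ->
  (forall w, N *m w = 0 -> exists a, w = a *: v) -> \adj N != 0.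
Proof.
move=> hN v0 Nv ker; apply/eqP => adj0.
have [i0 vi0] : exists i0, v i0 0 != 0.
  apply/existsP; apply: contra_neqT v0; rewrite negb_exists => /forallP h.
  by apply/matrixP => i j; rewrite ord1 mxE; apply/eqP; rewrite -[_ == _]negbK.
pose N' : 'M[C]_m := \matrix_(i, j) if i == i0 then (v j 0)^*%R else N i j.
have det0 : \det N' = 0.
  rewrite (expand_det_row _ i0) big1 // => j _.
  have -> : cofactor N' i0 j = (\adj N) j i0.
    rewrite mxE /cofactor; congr (_ * \det _); apply/matrixP => k l.
    by rewrite !mxE eq_sym (negbTE (neq_lift _ _)).
  by rewrite adj0 [X in _ * X]mxE mulr0.
have /det0P[u u0 uN] : \det N'^T == 0 by rewrite det_tr det0.
have {u0} w0 : u^T != 0 by rewrite -[0]trmx0 (inj_eq trmx_inj).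
have {uN} : N' *m u^T = 0 by rewrite -[N']trmxK -trmx_mul uN trmx0.
move: (u^T) w0 => w w0 N'w.
have Nw i : i != i0 -> (N *m w) i 0 = 0.
  move=> /negbTE ii0; have /matrixP/(_ i 0) := N'w; rewrite !mxE => h.
  by rewrite -[RHS]h; apply: eq_bigr => j _; rewrite mxE ii0.
have vw : hdot v w = 0.
  have /matrixP/(_ i0 0) := N'w; rewrite !mxE hdotE => h.
  by rewrite -[RHS]h; apply: eq_bigr => j _; rewrite mxE eqxx.
have Nw0 : N *m w = 0.
  apply/matrixP => i j; rewrite ord1 [RHS]mxE; have [->|] := eqVneq i i0;
    last exact: Nw.
  have := hdot_mulmx v w hN; rewrite Nv hdotE (bigD1 i0) //= big1; last first.
    by move=> k ki0; rewrite Nw // mulr0.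
  rewrite addr0 [hdot 0 w]hdotE big1 => [/eqP|k _]; last by rewrite mxE rmorph0 mul0r.
  by rewrite mulf_eq0 conjC_eq0 (negbTE vi0) => /eqP.
have [a wa] := ker w Nw0.
move: vw; rewrite wa hdotZr => /eqP; rewrite mulf_eq0 hdot_eq0 (negbTE v0) orbF =>
  /eqP a0.
by move: w0; rewrite wa a0 scale0r eqxx.
Qed.

(** As N adj(N) = 0, the columns of the adjugate are multiples of v, so adj(N) = v r. As adj(N) N =
    0, also r N = 0, and N being Hermitian, the adjoint of r lies in the kernel too. So adj(N) is a
    multiple of v v^*, nonzero by [adj_neq0]. *)
Lemma adj_kernel (N : 'M[C]_m) (v : 'cV[C]_m) : N^t* = N -> v != 0 -> N *m v = 0 ->
  (forall w, N *m w = 0 -> exists a, w = a *: v) ->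
  exists2 c, c != 0 & \adj N = c *: lproj v.
Proof.
move=> hN v0 Nv ker.
have adj0 := adj_neq0 hN v0 Nv ker.
have det0 : \det N = 0.
  apply/eqP; rewrite -det_tr; apply/det0P; exists v^T;
    last by rewrite -trmx_mul Nv trmx0.
  by rewrite -[0]trmx0 (inj_eq trmx_inj).
have /fin_all_exists[a aE] j : exists a, col j (\adj N) = a *: v.
  by apply: ker; rewrite colE mulmxA mul_mx_adj det0 -scalemx1 scale0r mul0mx.
pose r : 'rV[C]_m := \row_j a j.
have adjE : \adj N = v *m r.
  apply/matrixP => i j; have /matrixP/(_ i 0) := aE j.
  by rewrite mxE => ->; rewrite !mxE big_ord1 mxE mulrC.
have rN : r *m N = 0.
  have h : v *m (r *m N) = 0 by rewrite mulmxA -adjE mul_adj_mx det0 -scalemx1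
    scale0r.
  have [i0 vi0] : exists i0, v i0 0 != 0.
    apply/existsP; apply: contra_neqT v0; rewrite negb_exists => /forallP h'.
    by apply/matrixP => i j; rewrite ord1 mxE; apply/eqP; rewrite -[_ == _]negbK.
  apply/matrixP => k j; rewrite ord1 [RHS]mxE; have /matrixP/(_ i0 j) := h.
  rewrite mxE big_ord1 [RHS]mxE => /eqP; rewrite mulf_eq0 (negbTE vi0) => /eqP //.
have [b rb] : exists b, r^t* = b *: v.
  by apply: ker; rewrite -[N]hN -map_mxM -trmx_mul rN trmx0 map_mx0.
have rE : r = b^*%R *: v^t*.
  rewrite -[r]trmxCK rb; apply/matrixP => i j.
  by rewrite !mxE rmorphM.
exists (b^*%R * hdot v v).
  apply: contra_neq adj0 => h; rewrite adjE rE -scalemxAr.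
  move: h => /eqP; rewrite mulf_eq0 hdot_eq0 (negbTE v0) orbF => /eqP ->.
  by rewrite scale0r.
by rewrite adjE rE -scalemxAr /lproj scalerA mulfK // hdot_eq0.
Qed.
End Adjugate.

(** * Smoothing a section *)

Section Smoothing.
Variable R : realType.
Local Notation C := R[i].
Variable n : nat.
Local Notation cV := 'cV[R]_n.
Local Notation K := [set x : cV | `|x| = 1].

(** The Euclidean norm which, unlike the maximum norm, is smooth away from 0. *)
Definition enorm (x : cV) : R := Num.sqrt (\sum_i x i 0 ^+ 2).

(** The cosine of the Euclidean angle between [x] and [y]. *)
Definition cosim (x y : cV) : R := \sum_i (x i 0 / enorm x) * (y i 0 / enorm y).

Lemma sqsum_gt0 (x : cV) : x != 0 -> 0 < \sum_i x i 0 ^+ 2.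
Proof.
move=> x0; rewrite lt_neqAle sumr_ge0 ?andbT => [|i _]; last exact: sqr_ge0.
rewrite eq_sym; apply: contra_neq x0 => /eqP.
rewrite psumr_eq0 => [/allP h|i _]; last exact: sqr_ge0.
apply/matrixP => i j; rewrite ord1 mxE; apply/eqP.
by have := h i (mem_index_enum i); rewrite sqrf_eq0.
Qed.

Lemma enorm_gt0 (x : cV) : x != 0 -> 0 < enorm x.
Proof. by move=> x0; rewrite sqrtr_gt0 sqsum_gt0. Qed.

Lemma sum_unit (x : cV) : x != 0 -> \sum_i (x i 0 / enorm x) ^+ 2 = 1.
Proof.
move=> x0; rewrite (eq_bigr (fun i => x i 0 ^+ 2 * (enorm x) ^- 2)); last first.
  by move=> i _; rewrite exprMn exprVn.
rewrite -mulr_suml /enorm sqr_sqrtr ?divff ?gt_eqF ?sqsum_gt0 //.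
by rewrite ltW // sqsum_gt0.
Qed.

Lemma cosim_sub (x y : cV) : x != 0 -> y != 0 ->
  \sum_i (x i 0 / enorm x - y i 0 / enorm y) ^+ 2 = 2 - 2 * cosim x y.
Proof.
move=> x0 y0.
transitivity (\sum_i (x i 0 / enorm x) ^+ 2 + \sum_i (y i 0 / enorm y) ^+ 2 -
    2 * cosim x y).
  by rewrite /cosim mulr_sumr -big_split -sumrB /=; apply: eq_bigr => i _; ring.
by rewrite !sum_unit.
Qed.

Lemma cosim_add (x y : cV) : x != 0 -> y != 0 ->
  \sum_i (x i 0 / enorm x + y i 0 / enorm y) ^+ 2 = 2 + 2 * cosim x y.
Proof.
move=> x0 y0.
transitivity (\sum_i (x i 0 / enorm x) ^+ 2 + \sum_i (y i 0 / enorm y) ^+ 2 +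
    2 * cosim x y).
  by rewrite /cosim mulr_sumr -!big_split /=; apply: eq_bigr => i _; ring.
by rewrite !sum_unit.
Qed.

Lemma cosim_geN1 (x y : cV) : x != 0 -> y != 0 -> -1 <= cosim x y.
Proof.
move=> x0 y0; have := cosim_add x0 y0.
have : 0 <= \sum_i (x i 0 / enorm x + y i 0 / enorm y) ^+ 2.
  by apply: sumr_ge0 => i _; exact: sqr_ge0.
lra.
Qed.

Lemma cosimxx (x : cV) : x != 0 -> cosim x x = 1.
Proof.
by move=> x0; rewrite -[RHS](sum_unit x0); apply: eq_bigr => i _; rewrite expr2.
Qed.

(** Cosine 1 would make the points positive multiples of each other, hence equal, both having norm
    1. *)
Lemma cosim_lt1 (x y : cV) : K x -> K y -> x != y -> cosim x y < 1.
Proof.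
move=> x1 y1 xy; have x0 := norm1_neq0 x1; have y0 := norm1_neq0 y1.
have ge0 i : true -> 0 <= (x i 0 / enorm x - y i 0 / enorm y) ^+ 2.
  by move=> _; exact: sqr_ge0.
have S := cosim_sub x0 y0; have := sumr_ge0 (index_enum _) ge0.
rewrite le_eqVlt => /orP[|h]; last by move: h; rewrite S; lra.
rewrite eq_sym psumr_eq0 // => /allP h.
have xyE : x = (enorm x / enorm y) *: y.
  apply/matrixP => i j; rewrite ord1 mxE.
  have := h i (mem_index_enum i); rewrite sqrf_eq0 subr_eq0 => /eqP e.
  by rewrite mulrAC -mulrA -e mulrC divfK // gt_eqF // enorm_gt0.
have : enorm x / enorm y = 1.
  have := congr1 Num.norm xyE; rewrite normrZ x1 y1 mulr1 => ->.
  by rewrite ger0_norm // divr_ge0 // sqrtr_ge0.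
by move=> e1; move: xy; rewrite xyE e1 scale1r eqxx.
Qed.

Lemma open_neq0 : open [set x : cV | x != 0].
Proof.
rewrite (_ : [set x | _] = ~` [set 0]); last first.
  by apply/seteqP; split=> x /= /eqP.
apply: closed_openC; apply: accessible_closed_set1.
exact/hausdorff_accessible/norm_hausdorff.
Qed.

Lemma enorm_smooth : smooth_on [set x : cV | x != 0] enorm.
Proof.
move=> k; apply: (Ck_sqrt open_neq0) => [x|]; first exact: sqsum_gt0.
apply: (@smooth_sum _ _ _ _ _ (fun i (x : cV) => x i 0 ^+ 2) open_neq0) => i.
by apply: smooth_exp; [exact: open_neq0 | apply: smooth_coord; exact: open_neq0].
Qed.

Lemma cosim_smooth (y : cV) : smooth_on [set x : cV | x != 0] (cosim ^~ y).
Proof.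
have oU := open_neq0; move=> k.
apply: (@smooth_sum _ _ _ _ _ (fun i (x : cV) =>
  (x i 0 / enorm x) * (y i 0 / enorm y)) oU).
move=> i k'; apply: (Ck_mul oU); last exact: Ck_cst.
apply: (Ck_mul oU); first exact: smooth_coord.
by apply: (Ck_inv oU); [move=> x x0; rewrite gt_eqF // enorm_gt0 | exact:
  enorm_smooth].
Qed.

Lemma enorm_continuous (x : cV) : x != 0 -> {for x, continuous enorm}.
Proof. exact: (enorm_smooth 0%N). Qed.

Lemma cosimZ (r : R) (x y : cV) : 0 < r -> cosim (r *: x) y = cosim x y.
Proof.
move=> r0; rewrite /cosim /enorm.
have -> : \sum_i (r *: x) i 0 ^+ 2 = r ^+ 2 * \sum_i x i 0 ^+ 2.
  by rewrite mulr_sumr; apply: eq_bigr => i _; rewrite mxE exprMn.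
rewrite sqrtrM ?sqr_ge0 // sqrtr_sqr gtr0_norm //.
apply: eq_bigr => i _; congr (_ * _); rewrite mxE invfM mulrACA.
by rewrite divff ?mul1r // gt_eqF.
Qed.

Lemma cosim_continuous (z : cV * cV) : z.1 != 0 -> z.2 != 0 ->
  {for z, continuous (fun z : cV * cV => cosim z.1 z.2)}.
Proof.
move=> z1 z2.
have cq (f : cV * cV -> cV) i : f z != 0 -> {for z, continuous f} ->
    {for z, continuous (fun z => f z i 0 / enorm (f z))}.
  move=> fz cf; apply: continuousM.
    by apply: (continuous_comp (g := fun x : cV => x i 0) cf); exact:
      coord_continuous.
  apply: continuousV; first by rewrite gt_eqF // enorm_gt0.
  by apply: (continuous_comp (g := enorm) cf); exact: enorm_continuous.
have c i : {for z, continuous (fun z : cV * cV =>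
  z.1 i 0 / enorm z.1 * (z.2 i 0 / enorm z.2))}.
  apply: continuousM.
    by apply: (cq fst); [exact: z1 | exact: continuous_fst].
  by apply: (cq snd); [exact: z2 | exact: continuous_snd].
rewrite /cosim; elim: (index_enum _) => [|i r IH].
  rewrite (_ : (fun _ => _) = fun=> 0); first exact: cst_continuous.
  by apply/funext => ?; rewrite big_nil.
rewrite (_ : (fun _ => _) = fun z : cV * cV =>
  z.1 i 0 / enorm z.1 * (z.2 i 0 / enorm z.2) +
  \sum_(i <- r) z.1 i 0 / enorm z.1 * (z.2 i 0 / enorm z.2)).
  exact: continuousD.
by apply/funext => ?; rewrite big_cons.
Qed.

(* The weights (1 + cos)^N concentrate, for large N, at the points y near x, where
   W y is close to W x; they are smooth and homogeneous of degree 0 in x. *)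
Lemma smoothing (m : nat) (W : cV -> 'cV[C]_m) :
  (forall x, x != 0 -> mcont W x) -> (forall x, x != 0 -> W x != 0) ->
  (forall (r : R) x, 0 < r -> x != 0 -> W (r *: x) = W x) ->
  exists u : cV -> 'cV[C]_m,
    (forall k, csmooth_on [set x : cV | x != 0] (fun x => u x k 0)) /\
    forall x, x != 0 -> hdot (W x) (u x) != 0.
Proof.
move=> Wc W0 Wh.
pose Phi (z : cV * cV) := complex.Re (hdot (W z.1) (W z.2)).
have Phic z : z.1 != 0 -> z.2 != 0 -> {for z, continuous Phi}.
  move=> z1 z2.
  have c1 : mcont (fun z : cV * cV => W z.1) z.
    by apply: (mcont_comp (g := fst)); [exact: continuous_fst | exact: Wc].
  have c2 : mcont (fun z : cV * cV => W z.2) z.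
    by apply: (mcont_comp (g := snd)); [exact: continuous_snd | exact: Wc].
  by have [] := mcontM (mcont_adjoint c1) c2 0 0.
have cK : compact K by exact: compact_sphere.
have cKK : compact (K `*` K) by exact: compact_setX.
have [K0|/set0P nK] := eqVneq K set0.
  exists (fun=> 0); split; first by move=> k; exact: csmooth_cst.
  by move=> x x0; have : K (unitize x) by [exact: norm_unitize]; rewrite K0.
have [c c0 cP] : exists2 c, 0 < c & forall x, K x -> c < Phi (x, x).
  have [|x0 Kx0 x0P] := @compact_EVT_min cV R (fun x => Phi (x, x)) K nK cK.
    apply: continuous_in_subspaceT => x; rewrite inE => Kx.
    apply: (continuous_comp (f := fun x : cV => (x, x)) (g := Phi)).
      exact: continuous_pair.
    by apply: Phic; exact: norm1_neq0.
  move: Kx0; rewrite inE => Kx0.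
  have Px0 : 0 < Phi (x0, x0).
    have /hdot_gt0 := W0 x0 (norm1_neq0 Kx0).
    by rewrite ltcE => /andP[].
  exists (Phi (x0, x0) / 2) => [|x Kx]; first by rewrite divr_gt0.
  have := x0P x; rewrite inE => /(_ Kx); lra.
have [M M0 MP] : exists2 M, 0 < M & forall x y, K x -> K y -> `|Phi (x, y)| <= M.
  have [x0 Kx0] := nK.
  have [||z _ zP] := @compact_EVT_max (cV * cV)%type R (fun z =>
    `|Phi z|) (K `*` K) _ cKK.
  - by exists (x0, x0).
  - apply: continuous_in_subspaceT => z; rewrite inE => -[z1 z2].
    apply: (continuous_comp (f := Phi) (g := fun r : R => `|r|)); last exact:
      norm_continuous.
    by apply: Phic; exact: norm1_neq0.
  exists (`|Phi z| + 1) => [|x y Kx Ky]; first by rewrite ltr_wpDl.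
  by have := zP (x, y); rewrite inE => /(_ (conj Kx Ky)); lra.
(* A pair in [K] with [Phi] at most [c] is off the diagonal, so its cosine is less than 1;
   compactness yields one [b] for all pairs. *)
have [b b01 bP] : exists2 b, 0 < b < 1 / 2 & forall x y, K x -> K y ->
    1 - 2 * b < cosim x y -> c < Phi (x, y).
  pose P (b : R) (z : cV * cV) := 1 - 2 * b < cosim z.1 z.2 -> c < Phi z.
  have ncov := (compact_near_coveringP _).1 cKK.
  have nP := ncov R 0^'+ P _.
  have {}nP : \forall b \near 0^'+, K `*` K `<=` P b.
    apply: nP => z [/= Kx Ky].
    have z1 : z.1 != 0 by exact: norm1_neq0.
    have z2 : z.2 != 0 by exact: norm1_neq0.
    have [cPhi|cPhi] := ltP c (Phi z).
      have nz : nbhs z [set z' | c < Phi z'] by exact: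
        (cvgr_gt _ (Phic z z1 z2) _ cPhi).
      exists ([set z' | c < Phi z'], setT); first by split => //; exact: filterT.
      by move=> [z' b] [/= h _] _.
    have xy : z.1 != z.2.
      apply: contraTneq cPhi => e; rewrite -ltNge.
      by rewrite (_ : z = (z.1, z.1)); [exact: cP | case: (z) e => ? ? /= ->].
    have s1 := cosim_lt1 Kx Ky xy.
    pose d := (1 - cosim z.1 z.2) / 4.
    have sd : cosim z.1 z.2 < 1 - 2 * d by rewrite /d; lra.
    have nz : nbhs z [set z' : cV * cV | cosim z'.1 z'.2 < 1 - 2 * d].
      exact: (cvgr_lt _ (cosim_continuous z1 z2) _ sd).
    exists ([set z' : cV * cV | cosim z'.1 z'.2 < 1 - 2 * d], [set b | b < d]).
      by split => //; apply: nbhs_right_lt; rewrite /d; lra.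
    by move=> [z' b] [/= h1 h2]; rewrite /P; lra.
  have nb : \forall b \near (0 : R)^'+, b < 1 / 2 by apply: nbhs_right_lt; lra.
  have n0 : \forall b \near (0 : R)^'+, 0 < b by exact: nbhs_right_gt.
  have [b bPP] := @filter_ex _ _ (at_right_proper_filter (0 :
    R)) _ (filterI (filterI nP nb) n0).
  have [bP b2] := bPP.1; have b0 := bPP.2.
  exists b; first by apply/andP; split.
  by move=> x y Kx Ky; exact: (bP (x, y) (conj Kx Ky)).
(* The net uses [b] where [bP] has [2 * b]: at each point one favourable weight is at least (2 -
   b)^N, while the terms that may be negative have weights at most (2 - 2b)^N. *)
have [D DK Dnet] : exists2 D : seq cV, (forall y, y \in D -> K y) & forall x, K x ->
    exists2 y, y \in D & 1 - b < cosim x y.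
  pose O y := interior [set x : cV | 1 - b < cosim x y].
  have cKc : cover_compact K by rewrite -compact_cover.
  have [|x Kx|D DK KD] := cKc cV K O.
  - by move=> y _; exact: open_interior.
  - exists x => //; rewrite /O /interior /=.
    have x0 := norm1_neq0 Kx.
    have cx : {for x, continuous (cosim ^~ x)}.
      by have := @cosim_smooth x 0%N x x0.
    apply: (cvgr_gt _ cx); rewrite cosimxx //; lra.
  exists (finmap.enum_fset D) => [y yD|x Kx]; first by have := DK y yD; rewrite inE.
  have [y /= yD Oy] := KD x Kx; exists y => //.
  exact: (interior_subset Oy).
(* As (2 - 2b) / (2 - b) < 1, for large N a single favourable term outweighs all the negative
   ones. *)
have [N NP] : exists N : nat, (size D)%:R * M * (2 - 2 * b) ^+ N < (2 - b) ^+ N * c.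
  have b2 : 0 < 2 - b by lra.
  pose q := (2 - 2 * b) / (2 - b).
  have q1 : `|q| < 1.
    by rewrite ger0_norm /q ?divr_ge0 ?ltr_pdivrMr //; lra.
  pose a := (size D)%:R * M + 1.
  have a0 : 0 < a by rewrite ltr_wpDl // mulr_ge0 // ltW.
  have ca : 0 < c / a by rewrite divr_gt0.
  have [N _ /(_ N (leqnn N)) /= h] : \forall N \near \oo, q ^+ N < c / a.
    exact: (cvgr_lt _ (cvg_expr q1) _ ca).
  exists N; move: h; rewrite /q exprMn exprVn ltr_pdivrMr ?exprn_gt0 //.
  have p0 : 0 <= (2 - 2 * b) ^+ N by rewrite exprn_ge0 //; lra.
  rewrite mulrAC ltr_pdivlMr // [c * _]mulrC; apply: le_lt_trans.
  by rewrite mulrC ler_wpM2l // /a lerDl.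
exists (fun x => \sum_(y <- D) ((1 + cosim x y) ^+ N)%:C *: W y); split.
  move=> k.
  rewrite (_ : (fun x => _) = fun x => \sum_(y <- D) ((1 + cosim x y) ^+ N)%:C * W y
    k 0).
    apply: (csmooth_sum open_neq0 _ (P := predT) (F := fun y x =>
      ((1 + cosim x y) ^+ N)%:C * W y k 0)).
    move=> y _; apply: (csmooth_mul open_neq0); last exact: csmooth_cst.
    apply: csmooth_real; apply: (smooth_exp N open_neq0) => k'.
    by apply: (Ck_add open_neq0); [exact: Ck_cst | exact: cosim_smooth].
  by apply/funext => x; rewrite summxE; apply: eq_bigr => y _; rewrite mxE.
move=> x x0; set u := \sum_(y <- _) _.
have Kx : K (unitize x) by exact: norm_unitize.
have x0' : 0 < `|x|^-1 by rewrite invr_gt0 normr_gt0.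
pose A := (2 - 2 * b) ^+ N * M.
pose t y := (1 + cosim x y) ^+ N * Phi (unitize x, y).
have A0 : 0 <= A by rewrite mulr_ge0 ?exprn_ge0 ?(ltW M0) //; lra.
have t_ge y : y \in D -> - A <= t y.
  move=> yD; have Ky := DK y yD.
  have s0 : 0 <= 1 + cosim x y by have := cosim_geN1 x0 (norm1_neq0 Ky); lra.
  have [h|h] := ltP (1 - 2 * b) (cosim x y).
    apply: (@le_trans _ _ 0); first by rewrite oppr_le0.
    rewrite mulr_ge0 ?exprn_ge0 // ltW // (lt_trans c0) // bP //.
    by rewrite cosimZ.
  rewrite lerNl; apply: le_trans (ler_norm _) _.
  rewrite normrN normrM ger0_norm ?exprn_ge0 //.
  apply: ler_pM; rewrite ?exprn_ge0 ?MP //.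
  by apply: lerXn2r; rewrite ?nnegrE //; lra.
have sum_ge (r : seq cV) : {subset r <= D} -> - ((size r)%:R * A) <= \sum_(y <- r) t
  y.
  elim: r => [|y r IH] sr; first by rewrite big_nil mul0r oppr0.
  rewrite big_cons /= -natr1 mulrDl mul1r opprD addrC.
  apply: lerD; first by apply: t_ge; apply: sr; rewrite mem_head.
  by apply: IH => z zr; apply: sr; rewrite in_cons zr orbT.
have hu : complex.Re (hdot (W x) u) = \sum_(y <- D) t y.
  rewrite /u hdot_sumr (big_morph _ (raddfD (@complex.Re R)) (raddf0 _)) /=.
  apply: eq_bigr => y _; rewrite hdotZr -(Wh _ x x0') // /t /Phi /=.
  by rewrite mulrC; case: (hdot _ _) => p q /=; rewrite mulr0 subr0 mulrC.
have [y yD hy] := Dnet _ Kx; have Ky := DK y yD.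
suff : 0 < \sum_(y <- D) t y.
  by rewrite -hu; apply: contraTneq => ->; rewrite ltxx.
rewrite (big_rem y) //=.
have h1 : - ((size D)%:R * A) <= \sum_(y <- rem y D) t y.
  apply: le_trans (sum_ge _ (@mem_rem _ _ _)).
  by rewrite lerN2 ler_wpM2r // ler_nat size_rem // leq_pred.
have h2 : (2 - b) ^+ N * c <= t y.
  have b2 : 1 - 2 * b < cosim (unitize x) y by lra.
  have := bP _ _ Kx Ky b2.
  move: hy; rewrite cosimZ // => hy h3.
  apply: ler_pM; rewrite ?(ltW c0) ?(ltW h3) ?exprn_ge0 //; first by lra.
  by apply: lerXn2r; rewrite ?nnegrE; lra.
move: NP h1 h2; rewrite /A mulrAC -mulrA; lra.
Qed.
End Smoothing.

(** * A smooth map of the sphere into C^m, m >= 2, avoids a direction *)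

Section Lipschitz.
Variable R : realType.

(** The mean value theorem along the segment, the differential being bounded by the sum of the
    moduli of the partial derivatives. That sum is bounded only on the compact cube surface, so the
    segment has to stay there, as it does inside a face. *)
Lemma lip_sphere (n : nat) (f : 'cV[R]_n -> R) :
  smooth_on [set x : 'cV[R]_n | x != 0] f ->
  exists2 L : R, 0 < L & forall x y : 'cV[R]_n,
    (forall t : R, 0 <= t <= 1 -> `|t *: (y - x) + x| = 1) -> `|f y - f x|
      <= L * `|y - x|.
Proof.
move=> sf.
pose G (x : 'cV[R]_n) := \sum_i `|'D_(delta_mx i 0) f x|.
have Gc x : x != 0 -> {for x, continuous G}.
  move=> x0; rewrite /G; elim: (index_enum _) => [|i r IH].
    rewrite (_ : (fun _ => _) = fun=> 0); first exact: cst_continuous.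
    by apply/funext => ?; rewrite big_nil.
  rewrite (_ : (fun _ => _) = fun x => `|'D_(delta_mx i 0) f x| +
    \sum_(j <- r) `|'D_(delta_mx j 0) f x|); last by apply/funext => ?;
      rewrite big_cons.
  apply: continuousD => //.
  apply: (continuous_comp (f := 'D_(delta_mx i 0) f) (g := fun r : R => `|r|));
    last exact: norm_continuous.
  have [_ h] := sf 1%N; exact: (h (delta_mx i 0) x x0).
have [K0|/set0P nK] := eqVneq [set x : 'cV[R]_n | `|x| = 1] set0.
  exists 1 => // x y h; have : [set x : 'cV[R]_n | `|x| = 1] (0 *: (y - x) + x).
    by apply: h; rewrite lexx ler01.
  by rewrite K0.
have [|c _ cP] := @compact_EVT_max _ R G _ nK (@compact_sphere R n).
  apply: continuous_in_subspaceT => x; rewrite inE => x1.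
  by apply: Gc; exact: norm1_neq0.
have G0 x : 0 <= G x by apply: sumr_ge0.
exists (G c + 1) => [|x y h]; first by rewrite ltr_wpDl.
pose p (t : R) := t *: (y - x) + x.
have df z : z != 0 -> differentiable f z by have [h' _] := sf 1%N; exact: h'.
have p0 t : 0 <= t <= 1 -> p t != 0 by move=> t01; apply: norm1_neq0; exact: h.
have dp t : is_diff t p (fun h => h *: (y - x)).
  have [d1 d2] := is_diffD (is_diff_scalel t (y - x)) (is_diff_cst x t).
  apply: DiffDef; first exact: d1.
  by rewrite (_ : p = *:%R^~ (y - x) + cst x) // d2; apply/funext => u;
    rewrite fctE addr0.
have bnd z : `|z| = 1 -> `|'d f z (y - x)| <= (G c + 1) * `|y - x|.
  move=> z1; have dz := df z (norm1_neq0 z1).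
  have e : y - x = \sum_i (y - x) i 0 *: delta_mx i 0.
    rewrite {1}[y - x]matrix_sum_delta; apply: eq_bigr => i _.
    by rewrite big_ord1.
  rewrite {1}e linear_sum /=; apply: le_trans (ler_norm_sum _ _ _) _.
  apply: (@le_trans _ _ (G z * `|y - x|)); last first.
    have := cP z; rewrite inE => /(_ z1) h1; rewrite ler_wpM2r //; lra.
  rewrite /G mulr_suml; apply: ler_sum => i _.
  rewrite linearZ /= normrM mulrC ler_pM // ?coord_le_norm //.
  by rewrite deriveE.
have dphi (t : R) : t \in `]0, 1[ -> is_derive t 1 (f \o p) ('d f (p t) (y - x)).
  rewrite in_itv /= => t01.
  have dft : differentiable f (p t) by apply/df/p0; lra.
  have dpt : differentiable p t by have [] := dp t.
  have dc := differentiable_comp dpt dft.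
  apply: DeriveDef; first exact: diff_derivable.
  rewrite deriveE // diff_comp //=.
  by have [_ ->] := dp t; rewrite scale1r.
have [|c' c01 cE] := MVT_segment ler01 dphi.
  apply: continuous_in_subspaceT => t; rewrite inE /= in_itv /= => t01.
  apply: differentiable_continuous; apply: differentiable_comp.
    by have [] := dp t.
  by apply/df/p0.
move: cE; rewrite /= /p scale1r scale0r add0r subrK subr0 mulr1 => ->.
by apply: bnd; apply: h; move: c01; rewrite in_itv.
Qed.

End Lipschitz.

(** * Cells on the surface of the cube *)

Section Cells.
Variables (R : realType) (n : nat).
Local Notation cV := 'cV[R]_n.+1.

Lemma norm_le_coord (p q : nat) (x : 'M[R]_(p, q)) (r : R) : 0 <= r ->
  (forall i j, `|x i j| <= r) -> `|x| <= r.
Proof.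
move=> r0 h; have [->|x0] := eqVneq x 0; first by rewrite normr0.
by have [i [j ->]] := norm_coord x0.
Qed.

Definition face (x : cV) : 'I_n.+1 := odflt ord0 [pick i | `|x i 0| == 1].

Lemma faceP (x : cV) : `|x| = 1 -> `|x (face x) 0| = 1.
Proof.
move=> x1; rewrite /face; case: pickP => [i /eqP //|h].
have [i [j xi]] := norm_coord (norm1_neq0 x1).
by have := h i; rewrite -(ord1 j) -xi x1 eqxx.
Qed.

(* The cube surface max |x_i| = 1 cut into cells: the face, its sign, and the
   position of the other n coordinates on a grid of mesh 1/N. *)
Definition cell (N : nat) (x : cV) : 'I_n.+1 * bool * {ffun 'I_n -> 'I_(2 * N).+1} :=
  (face x, 0 < x (face x) 0,
   [ffun j => inord (Num.truncn ((x (lift (face x) j) 0 + 1) * N%:R))]).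

(** The same coordinate with the same sign puts both points in one face, which is convex; equal
    truncations after scaling by [N] bound the other differences by 1/N. *)
Lemma cell_close (N : nat) (x y : cV) : (0 < N)%N -> `|x| = 1 -> `|y| = 1 ->
  cell N x = cell N y ->
  `|y - x| <= N%:R^-1 /\ forall t : R, 0 <= t <= 1 -> `|t *: (y - x) + x| = 1.
Proof.
move=> N0 x1 y1 [fxy sxy /ffunP exy].
have N0' : 0 < N%:R :> R by rewrite ltr0n.
have fx := faceP x1; have := faceP y1; rewrite -fxy => fy.
rewrite -fxy in sxy.
have eqf : x (face x) 0 = y (face x) 0.
  move: sxy fx fy; case: (ltP 0 (x (face x) 0)) => hx; case: ltP => hy // _.
    by rewrite !gtr0_norm // => -> ->.
  by rewrite !ler0_norm // => <- /oppr_inj.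
have b1 (z : cV) i : `|z| = 1 -> -1 <= z i 0 <= 1.
  by move=> z1; rewrite -ler_norml -z1 coord_le_norm.
split.
  apply: norm_le_coord => [|i j]; first by rewrite invr_ge0 ltW.
  rewrite ord1 !mxE; case: (unliftP (face x) i) => [k ->|->]; last first.
    by rewrite eqf subrr normr0 invr_ge0 ltW.
  have := exy k; rewrite !ffunE -fxy => e.
  set a := x _ _ in e *; set b := y _ _ in e *.
  have /andP[a1 a2] : -1 <= a <= 1 by exact: b1.
  have /andP[c1 c2] : -1 <= b <= 1 by exact: b1.
  (* The value c = 1 has index 2N, whence 2N + 1 indices per coordinate. *)
  have tb (c : R) : -1 <= c -> c <= 1 -> (Num.truncn ((c + 1) * N%:R) < (2 * N).+1)%N.
    move=> h1 h2; rewrite truncn_lt_nat; last by rewrite mulr_ge0 ?(ltW N0') //; lra.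
    rewrite -natr1 natrM; have : (c + 1) * N%:R <= 2 * N%:R by rewrite ler_wpM2r
      ?(ltW N0') //; lra.
    lra.
  have {}e := congr1 val e; rewrite /= !inordK ?tb // in e.
  have /truncn_itv/andP[l1 l2] : 0 <= (a + 1) * N%:R by rewrite mulr_ge0 ?(ltW N0')
    //; lra.
  have /truncn_itv/andP[l3 l4] : 0 <= (b + 1) * N%:R by rewrite mulr_ge0 ?(ltW N0')
    //; lra.
  rewrite e in l1 l2; move: l1 l2 l3 l4; rewrite -natr1; set T := (_%:R : R) =>
    l1 l2 l3 l4.
  rewrite ler_norml -div1r lerNl !ler_pdivlMr // mulNr; lra.
move=> t t01; apply/eqP; rewrite eq_le; apply/andP; split.
  apply: norm_le_coord => // i j; rewrite ord1 !mxE ler_norml.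
  have := b1 x i x1; have := b1 y i y1; move: (x i 0) (y i 0) => a b; nra.
rewrite -fx; apply: le_trans (coord_le_norm _ (face x) 0).
by rewrite !mxE -eqf subrr mulr0 add0r.
Qed.

Lemma card_cell (N : nat) : #|{: 'I_n.+1 * bool * {ffun 'I_n -> 'I_(2 * N).+1}}| =
  (n.+1 * 2 * (2 * N).+1 ^ n)%N.
Proof. by rewrite !card_prod card_ffun !card_ord card_bool. Qed.

End Cells.

(** * A direction never opposite to the section *)

Section Avoid.
Variables (R : realType) (m : nat) (v : 'cV[R]_3 -> 'cV[R[i]]_m.+2).
Local Notation C := R[i].
Hypothesis v_smooth : forall k, csmooth_on [set x : 'cV[R]_3 | x != 0] (fun x =>
  v x k 0).
Hypothesis v_neq0 : forall x, x != 0 -> v x != 0.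
Local Notation K := [set x : 'cV[R]_3 | `|x| = 1].

(** With the first real coordinate fixed to 1, this affine 3-space meets each ray at most once, and
    the factor of a multiple of a grid vector is read off that coordinate. *)
Definition gridvec (b c d : R) : 'cV[C]_m.+2 :=
  \col_k (if k == 0 then 1 +i* b else if k == lift ord0 ord0 then c +i* d else 0).

Lemma gridvec_neq0 b c d : gridvec b c d != 0.
Proof.
apply/eqP => /matrixP/(_ 0 0); rewrite !mxE eqxx => /eqP; rewrite eq_complex /=.
by rewrite oner_eq0.
Qed.

Lemma hdot_gridvec b c d :
  hdot (gridvec b c d) (gridvec b c d) = (1 + b ^+ 2 + c ^+ 2 + d ^+ 2)%:C.
Proof.
rewrite hdotE (bigD1 0) //= (bigD1 (lift ord0 ord0)) //= big1 => [|i /andP[i0 i1]].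
  rewrite !mxE !eqxx /= addr0; apply/eqP; rewrite eq_complex /=.
  by apply/andP; split; apply/eqP; ring.
by rewrite !mxE (negbTE i0) (negbTE i1) mulr0.
Qed.

Definition rcoord (i : 'I_4) (x : 'cV[R]_3) : R :=
  [:: complex.Re (v x 0 0); complex.Im (v x 0 0);
      complex.Re (v x (lift ord0 ord0) 0); complex.Im (v x (lift ord0 ord0) 0)]`_i.

Lemma rcoord_lip : exists2 L : R, 0 < L & forall i (x y : 'cV[R]_3),
    (forall t : R, 0 <= t <= 1 -> `|t *: (y - x) + x| = 1) ->
    `|rcoord i y - rcoord i x| <= L * `|y - x|.
Proof.
have /fin_all_exists2[L L0 LP] (i : 'I_4) : exists2 L : R, 0 < L & forall (x y :
  'cV[R]_3),
    (forall t : R, 0 <= t <= 1 -> `|t *: (y - x) + x| = 1) ->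
    `|rcoord i y - rcoord i x| <= L * `|y - x|.
  have [s1 s2] := v_smooth 0; have [s3 s4] := v_smooth (lift ord0 ord0).
  by case: i => -[|[|[|[|//]]]] ?; rewrite /rcoord /=; exact: lip_sphere.
exists (\sum_i L i) => [|i x y h].
  by rewrite (bigD1 ord0) //= ltr_pwDl // sumr_ge0 // => i _; exact: ltW.
apply: le_trans (LP i x y h) _; rewrite ler_wpM2r //.
by rewrite (bigD1 i) //= lerDl sumr_ge0 // => j _; exact: ltW.
Qed.

(** On the compact sphere |v|^2 has a minimum mu > 0, and grid vectors with parameters in [0, 1]
    have Euclidean norm at most 2; hence sqrt(mu) / 2. *)
Lemma v_lower : exists2 l : R, 0 < l & forall x b c d (a : R), `|x| = 1 ->
  0 <= b <= 1 -> 0 <= c <= 1 -> 0 <= d <= 1 -> v x = (- a)%:C *: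
    gridvec b c d -> 0 <= a ->
  l <= a.
Proof.
have [K0|/set0P nK] := eqVneq K set0.
  exists 1 => // x b c d a x1; have : K x by []; by rewrite K0.
have [|x0 Kx0 x0P] := @compact_EVT_min _ R (fun x =>
  complex.Re (hdot (v x) (v x))) _ nK (@compact_sphere R 3).
  apply: continuous_in_subspaceT => x; rewrite inE => x1.
  have cv : mcont v x.
    move=> i j; rewrite ord1; apply: (csmooth_ccont _ (v_smooth i)); exact:
      norm1_neq0.
  by have [] := mcontM (mcont_adjoint cv) cv 0 0.
move: Kx0; rewrite inE => Kx0.
set mu := complex.Re _ in x0P.
have mu0 : 0 < mu.
  by have := hdot_gt0 (v_neq0 (norm1_neq0 Kx0)); rewrite ltcE => /andP[].
exists (Num.sqrt mu / 2) => [|x b c d a x1 b01 c01 d01 vx a0].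
  by rewrite divr_gt0 // sqrtr_gt0.
have h : mu <= a ^+ 2 * (1 + b ^+ 2 + c ^+ 2 + d ^+ 2).
  have := x0P x; rewrite inE => /(_ x1) hh; apply: le_trans hh _.
  rewrite vx hdotZl hdotZr hdot_gridvec.
  rewrite (_ : ((- a)%:C)^*%R = (- a)%:C); last by apply/eqP;
    rewrite eq_complex /= oppr0 !eqxx.
  by rewrite -!(rmorphM (real_complex R)) /= mulrA mulrNN -expr2.
have h4 : mu <= (a * 2) ^+ 2.
  have sq (z : R) : 0 <= z <= 1 -> z ^+ 2 <= 1.
    by move=> /andP[z0 z1]; rewrite exprn_ile1.
  have := sq b b01; have := sq c c01; have := sq d d01 => d2 c2 b2.
  apply: le_trans h _; rewrite exprMn ler_wpM2l ?sqr_ge0 //; lra.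
rewrite ler_pdivrMr // -[leRHS]ger0_norm ?mulr_ge0 // -sqrtr_sqr.
exact: ler_wsqrtr.
Qed.

Lemma natr_dist_lt1 (i j : nat) : `|i%:R - j%:R| < 1 :> R -> i = j.
Proof.
rewrite ltr_norml => /andP[h1 h2]; apply/eqP; rewrite eqn_leq.
by apply/andP; split; rewrite leqNgt; apply/negP; rewrite -(ler_nat R) -natr1; lra.
Qed.

(* Pigeonhole: v being Lipschitz, a cell of mesh 1/N cannot contain two points
   where v is opposite to grid vectors 1/n apart if N is a large multiple of n, and
   there are O(n^2) cells for n^3 grid vectors. *)
Lemma avoid : exists2 w : 'cV[C]_m.+2, w != 0 &
  forall x (t : R), `|x| = 1 -> 0 <= t <= 1 -> (1 - t)%:C *: v x + t%:C *: w != 0.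
Proof.
have [//|H] := pselect (exists2 w : 'cV[C]_m.+2, w != 0 &
  forall x (t : R), `|x| = 1 -> 0 <= t <= 1 -> (1 - t)%:C *: v x + t%:C *: w != 0).
(* If no vector is avoided, the segment from some [v x] to the grid vector w vanishes at a time t.
   Since w is nonzero, t is not 1, and v x = - a w with a = t / (1 - t). *)
have bad b c d : exists xa : 'cV[R]_3 * R, [/\ `|xa.1| = 1, 0 <= xa.2 &
    v xa.1 = (- xa.2)%:C *: gridvec b c d].
  apply: contrapT => nb; apply: H; exists (gridvec b c d); first exact: gridvec_neq0.
  move=> x t x1 t01; apply/eqP => h; apply: nb.
  have t1 : t != 1.
    apply: contra_eq_neq h => ->; rewrite subrr !rmorph0 scale0r add0r rmorph1
      scale1r.
    exact: gridvec_neq0.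
  have t1' : 0 < 1 - t by rewrite subr_gt0 lt_neqAle t1; lra.
  have t1'' : (1 - t)%:C != 0 :> C.
    by rewrite (_ : 0 = (0 : R)%:C) // (inj_eq (@complexI R)) gt_eqF.
  exists (x, t / (1 - t)); split => //=; first by rewrite divr_ge0 ?(ltW t1') //; lra.
  apply: (scalerI t1''); rewrite scalerA -(rmorphM (real_complex R)) /= mulrN mulrC
    divfK ?gt_eqF //.
  by apply/eqP; rewrite -subr_eq0 rmorphN scaleNr opprK h.
have [L L0 LP] := rcoord_lip.
have [l l0 lP] := v_lower.
(* Larger than 2 L / l, so that [key] can bring the difference of two grid indices below 1. *)
pose Lam := (Num.truncn (2 * L / l)).+1.
have LamP : 2 * L / l < Lam%:R by rewrite real_truncnS_gt // num_real.
(* There are 6 (2N + 1)^2 cells, at most 6 n'^2 (2 Lam + 1)^2 = n'^3, against (n' + 1)^3 grid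
   vectors. *)
pose n' := (6 * (2 * Lam + 1) ^ 2)%N.
have n'0 : (0 < n')%N by rewrite /n' muln_gt0 expn_gt0 addn1.
pose N := (n' * Lam)%N.
have N0 : (0 < N)%N by rewrite muln_gt0 n'0.
pose T := ('I_n'.+1 * 'I_n'.+1 * 'I_n'.+1)%type.
pose be (i : 'I_n'.+1) : R := i%:R / n'%:R.
have n'R : 0 < n'%:R :> R by rewrite ltr0n.
have be01 i : 0 <= be i <= 1.
  by rewrite /be divr_ge0 // ler_pdivrMr // mul1r ler_nat -ltnS ltn_ord.
have /fin_all_exists[X XP] (p : T) := bad (be p.1.1) (be p.1.2) (be p.2).
suff inj : injective (fun p : T => cell N (X p).1).
  have := leq_card _ inj; rewrite card_cell !card_prod !card_ord leqNgt => /negP[].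
  have hN : ((2 * N).+1 <= n' * (2 * Lam + 1))%N.
    by rewrite /N mulnDr muln1 mulnCA -addn1 leq_add2l.
  apply: (@leq_ltn_trans (3 * 2 * (n' * (2 * Lam + 1)) ^ 2)%N).
    by rewrite leq_mul2l leq_exp2r.
  have -> : (3 * 2 * (n' * (2 * Lam + 1)) ^ 2 = n' ^ 3)%N.
    by rewrite expnMn mulnCA (_ : 3 * 2 = 6)%N // -/n' -expnSr.
  by rewrite (_ : n'.+1 * n'.+1 * n'.+1 = n'.+1 ^ 3)%N ?ltn_exp2r // !expnS mulnA
    muln1.
move=> p q pq.
have [p1 p2 p3] := XP p; have [q1 q2 q3] := XP q.
have [d1 seg] := cell_close N0 p1 q1 pq.
set a := (X p).2 in p2 p3; set a' := (X q).2 in q2 q3.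
have la : l <= a' by apply: lP q3 q2.
have NR : 0 < N%:R :> R by rewrite ltr0n.
have LN i : `|rcoord i (X q).1 - rcoord i (X p).1| <= L / N%:R.
  by apply: le_trans (LP i _ _ seg) _; rewrite ler_wpM2l // ltW.
have r0 := LN (inord 0); have r1 := LN (inord 1); have r2 := LN (inord 2);
  have r3 := LN (inord 3).
rewrite /rcoord !inordK //= in r0 r1 r2 r3.
rewrite p3 q3 !mxE !eqxx /= ?mul0r ?mulr1 ?subr0 ?addr0 in r0 r1 r2 r3.
(* The first coordinate gives |a' - a| <= L / N; combined with the hypothesis this yields l |be j -
   be i| <= 2 L / N, and N = n' Lam makes |j - i| < 1. *)
have key (i j : 'I_n'.+1) : `|(- a') * be j - (- a) * be i| <= L / N%:R -> i = j.
  move=> h; apply/val_inj/esym/natr_dist_lt1.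
  have h0 : `|a' - a| <= L / N%:R by move: r0; rewrite -normrN opprD !opprK.
  have /andP[bi0 bi1] := be01 i.
  have e1 : a' * `|be j - be i| <= 2 * L / N%:R.
    rewrite -(ger0_norm q2) -normrM.
    rewrite (_ : a' * (be j - be i) = - (- a' * be j - - a * be i) - (a' - a) * be
      i); last by ring.
    apply: le_trans (ler_normB _ _) _; rewrite normrN normrM (ger0_norm bi0).
    have : `|a' - a| * be i <= L / N%:R.
      by apply: le_trans (ler_piMr _ bi1) h0.
    rewrite -mulrA mulr_natl mulr2n; move: h; lra.
  have e2 : l * `|be j - be i| <= 2 * L / N%:R.
    by apply: le_trans e1; rewrite ler_wpM2r.
  have e3 : be j - be i = (j%:R - i%:R) / n'%:R by rewrite /be -mulrBl.
  move: e2; rewrite e3 normrM (gtr0_norm (_ : 0 < n'%:R^-1)) ?invr_gt0 //.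
  rewrite /N natrM invfM => e2.
  have LR : 0 < Lam%:R :> R by rewrite ltr0n.
  have {}e2 : l * `|j%:R - i%:R| <= 2 * L / Lam%:R.
    rewrite -(ler_pM2r (_ : 0 < n'%:R^-1)) ?invr_gt0 //.
    by rewrite -!mulrA; rewrite -!mulrA in e2; rewrite [Lam%:R^-1 * _]mulrC.
  have e4 : 2 * L / Lam%:R < l by rewrite ltr_pdivrMr // [l * _]mulrC; move: LamP;
    rewrite ltr_pdivrMr.
  have e5 : `|j%:R - i%:R| < 1 :> R by rewrite -(ltr_pM2l l0) mulr1; exact:
    le_lt_trans e2 e4.
  exact: e5.
have E1 : p.1.1 = q.1.1 by exact: key r1.
have E2 : p.1.2 = q.1.2 by exact: key r2.
have E3 : p.2 = q.2 by exact: key r3.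
clear -E1 E2 E3; case: p q E1 E2 E3 => [[? ?] ?] [[? ?] ?] /=.
by move=> -> -> ->.
Qed.
End Avoid.

(** * Eigenlines of a homogeneous Hermitian symbol *)

Section Fiber.
Variables (R : realType) (d m : nat).
Local Notation C := R[i].
Local Notation cV := 'cV[R]_d.
Variables (s : R) (A : cV -> 'M[C]_m) (h : cV -> C) (f : cV -> projective_space R m).
Hypothesis A_smooth : forall j k, csmooth_on [set x : cV | x != 0] (fun x => A x j k).
Hypothesis A_homogeneous : forall (x : cV) (t : R), x != 0 -> 0 < t ->
  A (t *: x) = (t `^ s)%:C *: A x.
Hypothesis A_hermitian : forall x : cV, x != 0 -> A x \is hermsymmx.
Hypothesis h_smooth : csmooth_on [set x : cV | x != 0] h.
Hypothesis h_eigenvalue : forall x : cV, x != 0 -> eigenvalue (A x) (h x).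
Hypothesis f_eigenspace : forall x : cV, x != 0 ->
  forall v : 'cV[C]_m, (v \in line (f x)) = (A x *m v == h x *: v).

Definition char_mx_at (x : cV) : 'M[C]_m := (h x)%:M - A x.

Lemma A_adjoint x : x != 0 -> (A x)^t* = A x.
Proof. by move=> /A_hermitian /is_hermitianmxP; rewrite expr0 scale1r => <-. Qed.

Lemma char_mx_at_mul x (v : 'cV[C]_m) : char_mx_at x *m v = h x *: v - A x *m v.
Proof. by rewrite mulmxBl mul_scalar_mx. Qed.

Lemma char_mx_at_ker x (v : 'cV[C]_m) : x != 0 -> (v \in line (f x)) = (char_mx_at x
  *m v == 0).
Proof. by move=> x0; rewrite f_eigenspace // char_mx_at_mul subr_eq0 eq_sym. Qed.

Lemma h_real x : x != 0 -> h x = (complex.Re (h x))%:C.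
Proof.
move=> x0; have [v v0 Lv] := line_gen (f x).
have : v \in line (f x) by rewrite Lv memv_line.
rewrite f_eigenspace // => /eqP Av.
have e := hdot_mulmx v v (A_adjoint x0); rewrite Av hdotZl hdotZr in e.
have hv : hdot v v != 0 by rewrite hdot_eq0.
have := mulIf hv e; case: (h x) => a b /eqP; rewrite eq_complex /= eqxx /= => /eqP e'.
by congr (_ +i* _); lra.
Qed.

Lemma char_mx_at_adjoint x : x != 0 -> (char_mx_at x)^t* = char_mx_at x.
Proof.
move=> x0; apply/matrixP => i j; rewrite !mxE rmorphB /=.
have /matrixP/(_ i j) := A_adjoint x0; rewrite !mxE => ->; congr (_ - _).
rewrite rmorphMn /= eq_sym; congr (_ *+ _); rewrite (h_real x0).
by apply/eqP; rewrite eq_complex /= oppr0 !eqxx.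
Qed.

Lemma adj_char_mx_at x : x != 0 ->
  exists2 c, c != 0 & \adj (char_mx_at x) = c *: cproj (f x).
Proof.
move=> x0; have [v [v0 Lv ->]] := cproj_gen (f x).
apply: adj_kernel => //; first exact: char_mx_at_adjoint.
  by apply/eqP; rewrite -char_mx_at_ker // Lv memv_line.
by move=> w /eqP; rewrite -char_mx_at_ker // Lv => /vlineP.
Qed.

Lemma char_mx_at_smooth i j : csmooth_on [set x : cV | x != 0] (fun x =>
  char_mx_at x i j).
Proof.
rewrite (_ : (fun x => _) = fun x => h x * (i == j)%:R + (-1) * A x i j).
  apply: (csmooth_add (@open_neq0 R d)).
    by apply: (csmooth_mul (@open_neq0 R d)) => //; exact: csmooth_cst.
  by apply: (csmooth_mul (@open_neq0 R d)) => //; exact: csmooth_cst.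
by apply/funext => x; rewrite !mxE mulN1r mulr_natr.
Qed.

(** A projection onto a line has trace 1, so the factor in [adj_char_mx_at] is the trace of the
    adjugate; dividing by it expresses the eigenprojection through smooth functions. *)
Lemma fiber_proj_continuous x : x != 0 -> mcont (fun x => cproj (f x)) x.
Proof.
move=> x0.
have cA : mcont (fun x => \adj (char_mx_at x)) x.
  move=> i j; apply: (csmooth_ccont x0).
  exact: (csmooth_adj (@open_neq0 R d) char_mx_at_smooth).
have trE y : y != 0 -> \tr (\adj (char_mx_at y)) != 0 /\
    cproj (f y) = (\tr (\adj (char_mx_at y)))^-1 *: \adj (char_mx_at y).
  move=> y0; have [c c0 ->] := adj_char_mx_at y0.
  rewrite linearZ /= is_lproj_trace ?mulr1 //; last exact: cproj_lproj.
  by rewrite scalerA mulVf // scale1r.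
apply: (@mcont_near_eq _ _ _ _
  (fun y => (\tr (\adj (char_mx_at y)))^-1 *: \adj (char_mx_at y))).
  have : \forall y \near x, y != 0 by apply: open_nbhs_nbhs; split => //; exact:
    open_neq0.
  by apply: filterS => y y0; rewrite (trE y y0).2.
apply: mcontZ; last exact: cA.
apply: ccontV; first exact: (trE x x0).1.
by rewrite /mxtrace; apply: ccont_sum => i _; exact: cA.
Qed.

(* h (r x) / r^s is continuous in r, with values among the eigenvalues of A x. *)
Lemma h_homogeneous x (t : R) : x != 0 -> 0 < t -> h (t *: x) = (t `^ s)%:C * h x.
Proof.
move=> x0 t0.
pose g (r : R) := complex.Re (h (r *: x)) / r `^ s.
have rx0 (r : R) : 0 < r -> r *: x != 0.
  by move=> r0; rewrite scaler_eq0 negb_or x0 gt_eqF.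
have rs0 (r : R) : 0 < r -> r `^ s != 0 by move=> r0; rewrite gt_eqF // powR_gt0.
have gh (r : R) : 0 < r -> h (r *: x) = (r `^ s)%:C * (g r)%:C.
  move=> r0; rewrite h_real ?rx0 // -(rmorphM (real_complex R)) /= /g mulrC divfK //.
  exact: rs0.
have g_root (r : R) : 0 < r -> root (char_poly (A x)) (g r)%:C.
  move=> r0; rewrite -eigenvalue_root_char.
  have := h_eigenvalue (rx0 r r0); rewrite (A_homogeneous x0 r0) (gh r r0).
  move=> /eigenvalueP[v vA v0].
  apply/eigenvalueP; exists v => //.
  have k0 : (r `^ s)%:C != 0 :> C.
    by rewrite (_ : 0 = (0 : R)%:C) // (inj_eq (@complexI R)) rs0.
  by apply: (scalerI k0); rewrite scalemxAr vA scalerA.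
have g_cont (r : R) : 0 < r -> {for r, continuous g}.
  move=> r0; apply: continuousM.
    apply: (continuous_comp (f := fun r : R => r *: x) (g := fun y =>
      complex.Re (h y))).
      by apply: continuous_scale => //; exact: cst_continuous.
    by apply: (h_smooth.1 0%N); exact: rx0.
  apply: continuousV; first exact: rs0.
  apply: (@continuous_near_eq _ _ (fun r => expR (s * ln r))).
    have : \forall y \near r, 0 < y by exact: lt_nbhsr.
    by apply: filterS => y y0; rewrite /powR gt_eqF.
  apply: continuous_comp; last exact: continuous_expR.
  by apply: continuousM; [exact: cst_continuous | exact: continuous_ln].
have g_const (a b : R) : 0 < a -> a <= b -> g a = g b.
  move=> a0 ab; apply: contrapT => /eqP gab.
  have cg : {within `[a, b], continuous g}.
    apply: continuous_in_subspaceT => r; rewrite inE /= in_itv /= => /andP[ar _].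
    by apply: g_cont; exact: lt_le_trans ar.
  pose p := char_poly (A x).
  (* If g a and g b differed, the intermediate value theorem would make these [size p] distinct
     values roots of [p], one more than its degree. *)
  pose z (k : nat) := g a + (g b - g a) * (k%:R / (size p)%:R).
  have sp : 0 < (size p)%:R :> R.
    by rewrite ltr0n lt0n size_poly_eq0 monic_neq0 // char_poly_monic.
  have z_root k : (k < size p)%N -> root p (z k)%:C.
    move=> kp; have [|c c01 <-] := @IVT _ g a b (z k) ab cg; last first.
      apply: g_root; move: c01; rewrite in_itv /= => /andP[ac _].
      exact: lt_le_trans ac.
    have : 0 <= (k%:R / (size p)%:R : R) <= 1.
      by rewrite divr_ge0 //= ler_pdivrMr // mul1r ler_nat ltnW.
    rewrite /z; move: (k%:R / _ : R) => u u01.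
    by case: (leP (g a) (g b)) => ?; nra.
  have p0 : p != 0 by rewrite monic_neq0 // char_poly_monic.
  have := @max_poly_roots _ p [seq (z k)%:C | k <- iota 0 (size p)] p0.
  rewrite size_map size_iota ltnn => F; suff : false by []; apply: F.
    by apply/allP => c /mapP[k]; rewrite mem_iota => /andP[_ kp] ->; exact: z_root.
  rewrite map_inj_uniq ?iota_uniq // => k l /complexI /addrI.
  have gab' : g b - g a != 0 by rewrite subr_eq0 eq_sym.
  move=> /(mulfI gab'); have spV : (size p)%:R^-1 != 0 :> R by rewrite gt_eqF //
    invr_gt0.
  by move=> /(mulIf spV) /eqP; rewrite eqr_nat => /eqP.
have g1 : g t = g 1.
  by have [t1|/ltW t1] := leP t 1; [exact: g_const | rewrite (g_const 1 t)].
by rewrite gh // g1 -[x in RHS]scale1r gh // powR1 mul1r.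
Qed.

Lemma f_homogeneous x (t : R) : x != 0 -> 0 < t -> f (t *: x) = f x.
Proof.
move=> x0 t0; apply: val_inj; apply/vspaceP => v /=.
have tx0 : t *: x != 0 by rewrite scaler_eq0 negb_or x0 gt_eqF.
rewrite (f_eigenspace tx0) (f_eigenspace x0) (A_homogeneous x0 t0).
rewrite (h_homogeneous x0 t0) -scalemxAl -scalerA.
apply/eqP/eqP => [|-> //]; apply: scalerI.
by rewrite (_ : 0 = (0 : R)%:C) // (inj_eq (@complexI R)) gt_eqF // powR_gt0.
Qed.

(* adj (h - A) is smooth and is the projection on the eigenspace up to a nonzero
   factor, so it turns a smooth approximation of W into a smooth eigenvector. *)
Lemma section_smoothing (W : cV -> 'cV[C]_m) :
  (forall x, x != 0 -> mcont W x) ->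
  (forall x, x != 0 -> W x != 0 /\ cproj (f x) *m W x = W x) ->
  (forall (r : R) x, 0 < r -> x != 0 -> W (r *: x) = W x) ->
  exists v : cV -> 'cV[C]_m,
    (forall k, csmooth_on [set x : cV | x != 0] (fun x => v x k 0)) /\
    forall x, x != 0 -> v x != 0 /\ A x *m v x = h x *: v x.
Proof.
move=> Wc WP Wh.
have [|u [us uW]] := smoothing Wc _ Wh; first by move=> x x0; exact: (WP x x0).1.
exists (fun x => \adj (char_mx_at x) *m u x); split.
  move=> k.
  rewrite (_ : (fun x => _) = fun x => \sum_j (\adj (char_mx_at x)) k j * u x j 0).
    apply: (csmooth_sum (@open_neq0 R d) _ (P := predT)
      (F := fun j x => (\adj (char_mx_at x)) k j * u x j 0)) => j _.
    apply: (csmooth_mul (@open_neq0 R d)) => //.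
    exact: (csmooth_adj (@open_neq0 R d) char_mx_at_smooth).
  by apply/funext => x; rewrite mxE.
move=> x x0; have [c c0 adjE] := adj_char_mx_at x0; have [W0 WE] := WP x x0.
split.
  rewrite adjE (is_lproj_range (cproj_lproj _) W0 WE) -scalemxAl lprojE.
  rewrite scaler_eq0 negb_or c0 /= scaler_eq0 negb_or W0 andbT.
  by apply: mulf_neq0; [exact: uW | rewrite invr_neq0 // hdot_eq0].
apply/eqP; rewrite eq_sym -subr_eq0 -char_mx_at_mul mulmxA mul_mx_adj.
have -> : \det (char_mx_at x) = 0.
  have [v [v0 Lv _]] := cproj_gen (f x).
  apply/eqP; rewrite -det_tr; apply/det0P; exists v^T.
    by rewrite -[0]trmx0 (inj_eq trmx_inj).
  have : v \in line (f x) by rewrite Lv memv_line.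
  by rewrite char_mx_at_ker // => /eqP e; rewrite -trmx_mul e trmx0.
by rewrite -scalemx1 scale0r mul0mx.
Qed.

End Fiber.

(** * Null-homotopies and sections *)

Section Directions.
Variable R : realType.
Local Notation C := R[i].

Lemma unitizeZ n (x : 'cV[R]_n) (r : R) : 0 < r -> unitize (r *: x) = unitize x.
Proof.
move=> r0; rewrite /unitize normrZ gtr0_norm // scalerA.
by rewrite invfM mulrAC mulVf ?mul1r // gt_eqF.
Qed.

(** A homotopy is continuous only within [0, 1] x D; a map that stays in that set near [x], as
    [clamp] ensures, removes the restriction. *)
Lemma within_comp (S T U : topologicalType) (D : set T) (F : T -> U) (g :
  S -> T) (x : S) :
  {within D, continuous F} -> D (g x) -> (\forall y \near x, D (g y)) ->
  {for x, continuous g} -> {for x, continuous (fun y => F (g y))}.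
Proof.
move=> /subspace_continuousP cF Dx nD cg V nV.
have := cF _ Dx V nV; rewrite /= nbhs_simpl /within /= => h.
have h' := cg _ h; apply: filterS2 nD h' => y Dy; exact.
Qed.

(** The homotopy is run backwards: a generator of the constant line is the starting section, and its
    lift ends in the lines of [f]. *)
Lemma nullhomotopic_section (d m : nat) (f : 'cV[R]_d -> projective_space R m) :
  nullhomotopic_on R [set x : 'cV[R]_d | x != 0] f ->
  exists W : 'cV[R]_d -> 'cV[C]_m, forall x, `|x| = 1 ->
    [/\ mcont W x, W x != 0 & cproj (f x) *m W x = W x].
Proof.
move=> [c [H [Hc H0 H1]]].
have [w [w0 _ cw]] := cproj_gen c.
pose Q t (y : 'cV[R]_d) := cproj (H (clamp (1 - t), y)).
have I0 : 0 <= (0 : R) <= 1 by rewrite ler01 lexx.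
have I1 : 0 <= (1 : R) <= 1 by rewrite ler01 lexx.
have [t x x1|t x x1|x x1|x x1|V [Vc V0 VP]] := @lift_sphere R d m Q (fun=> w).
- apply: (mcont_comp (F := @cproj R m) (g := fun z : R * 'cV[R]_d =>
  H (clamp (1 - z.1), z.2))); last exact: cproj_continuous.
  apply: (within_comp (g := fun z : R * 'cV[R]_d => (clamp (1 - z.1), z.2)) Hc).
  + split; last exact: norm1_neq0.
    by rewrite /= in_itv; exact: clamp_itv.
  + have : \forall z \near (t, x), z.2 != 0.
      apply: (cvgr_neq0 _ (@continuous_snd _ _ (t, x))); exact: norm1_neq0.
    apply: filterS => z z0; split => //.
    by rewrite /= in_itv; exact: clamp_itv.
  + apply: continuous_pair; last exact: continuous_snd.
    apply: (continuous_comp _ (@clamp_continuous R _)).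
    by apply: continuousB; [exact: cst_continuous | exact: continuous_fst].
- exact: cproj_lproj.
- exact: mcont_cst.
- by rewrite /Q subr0 (clamp_id I1) (H1 _ (norm1_neq0 x1)) cw lproj_id.
exists (V 1) => x x1; have [Vn VQ] := VP 1 x x1 I1.
have x0 := norm1_neq0 x1; split; [|exact: Vn|].
  apply: (mcont_comp (F := fun z : R * 'cV[R]_d => V z.1 z.2)
    (g := fun y : 'cV[R]_d => ((1 : R), y))); last exact: Vc.
  by apply: continuous_pair => //; exact: cst_continuous.
by move: VQ; rewrite /Q subrr (clamp_id I0) (H0 _ x0).
Qed.

(* Retract to the surface of the cube, then move linearly to a vector avoided there. *)
Lemma section_nullhomotopic (m : nat) (v : 'cV[R]_3 -> 'cV[C]_m.+2)
    (f : 'cV[R]_3 -> projective_space R m.+2) :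
  (forall k, csmooth_on [set x : 'cV[R]_3 | x != 0] (fun x => v x k 0)) ->
  (forall x, x != 0 -> v x != 0 /\ v x \in line (f x)) ->
  nullhomotopic_on R [set x : 'cV[R]_3 | x != 0] f.
Proof.
move=> vs vP; have v0 x : x != 0 -> v x != 0 by move=> /vP[].
have [w w0 wP] := avoid vs v0.
(* [al] runs during the first half of the time and [be] during the second, because [wP] holds only
   on the surface of the cube. *)
pose al (t : R) := clamp (2 * t).
pose be (t : R) := clamp (2 * t - 1).
pose pa (z : R * 'cV[R]_3) := (1 - al z.1) *: z.2 + al z.1 *: unitize z.2.
pose G (z : R * 'cV[R]_3) := (1 - be z.1)%:C *: v (pa z) + (be z.1)%:C *: w.
have pa0 z : z.2 != 0 -> pa z != 0.
  move=> z0; rewrite /pa /unitize scalerA -scalerDl scaler_eq0 negb_or z0 andbT.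
  have /andP[a0 a1] := clamp_itv (2 * z.1); rewrite -/(al _) in a0 a1.
  have nz : 0 < `|z.2|^-1 by rewrite invr_gt0 normr_gt0.
  have [a1'|a1'] := ltP (al z.1) 1.
    by rewrite gt_eqF // ltr_pwDl ?subr_gt0 // mulr_ge0 // ltW.
  by rewrite (_ : al z.1 = 1) ?subrr ?add0r ?mul1r ?gt_eqF //; lra.
have G0 z : 0 <= z.1 <= 1 -> z.2 != 0 -> G z != 0.
  move=> t01 z0; have [t2|t2] := leP z.1 (1 / 2).
    rewrite /G (_ : be z.1 = 0); last by rewrite /be /clamp min_r ?max_l //; lra.
    by rewrite subr0 scale1r scale0r addr0; exact/v0/pa0.
  have a1 : al z.1 = 1 by rewrite /al /clamp min_l ?max_r //; lra.
  rewrite /G /pa a1 subrr scale0r add0r scale1r; apply: wP; first exact: norm_unitize.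
  exact: clamp_itv.
have Gc z : z.2 != 0 -> mcont G z.
  move=> z0.
  have c1 : {for z, continuous (fun z : R * 'cV[R]_3 => 2 * z.1)}.
    by apply: continuousM; [exact: cst_continuous | exact: continuous_fst].
  have ca : {for z, continuous (fun z : R * 'cV[R]_3 => al z.1)}.
    exact: (continuous_comp c1 (@clamp_continuous R _)).
  have cb : {for z, continuous (fun z : R * 'cV[R]_3 => be z.1)}.
    have c2 : {for z, continuous (fun z : R * 'cV[R]_3 => 2 * z.1 - 1)}.
      by apply: continuousB => //; exact: cst_continuous.
    exact: (continuous_comp c2 (@clamp_continuous R _)).
  have cp : {for z, continuous pa}.
    apply: continuousD.
      apply: continuous_scale; last exact: continuous_snd.
      by apply: continuousB => //; exact: cst_continuous.
    apply: continuous_scale; first exact: ca.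
    exact: (continuous_comp (@continuous_snd _ _ z) (unitize_continuous z0)).
  have cv : mcont v (pa z).
    by move=> i j; rewrite ord1; apply: (csmooth_ccont _ (vs i)); exact: pa0.
  apply: mcontD; apply: mcontZ.
  - by apply: ccont_real; apply: continuousB => //; exact: cst_continuous.
  - exact: (mcont_comp cp cv).
  - exact: ccont_real.
  - exact: mcont_cst.
have dl (u : 'cV[C]_m.+2) : u != 0 -> \dim <[u]>%VS == 1%N.
  by move=> u0; rewrite dim_vline u0.
(* The second branch is a default value; [G0] rules it out for times in [0, 1] and nonzero
   points. *)
pose H (z : R * 'cV[R]_3) : projective_space R m.+2 :=
  match pselect (G z != 0) with
  | left u => ProjectiveLine (dl _ u)
  | right _ => f z.2
  end.
have HE z : G z != 0 -> line (H z) = <[G z]>%VS.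
  by move=> g0; rewrite /H; case: pselect.
have I0 : 0 <= (0 : R) <= 1 by rewrite ler01 lexx.
have I1 : 0 <= (1 : R) <= 1 by rewrite ler01 lexx.
exists (ProjectiveLine (dl _ w0)), H; split.
- apply: continuous_in_subspaceT => z; rewrite inE => -[/= t01 z0].
  rewrite in_itv /= in t01.
  by apply: (continuous_into_projective (G := G)) => //; [exact: Gc | exact: G0].
- move=> x x0; apply: val_inj; rewrite /= HE; last exact: G0.
  have -> : G (0, x) = v x.
    rewrite /G /pa /al /be /= mulr0 (clamp_id I0) sub0r subr0 scale1r scale0r addr0.
    rewrite (_ : clamp (-1) = 0); last by rewrite /clamp min_r ?max_l //; lra.
    by rewrite subr0 scale1r scale0r addr0.
  have [vx vf] := vP x x0; apply/eqP; rewrite eqEdim.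
  by rewrite (eqP (line_dim (f x))) dim_vline vx andbT -memvE.
- move=> x x0; apply: val_inj; rewrite /= HE; last exact: G0.
  congr <[_]>%VS; rewrite /G /be /= mulr1 clamp_id; last by lra.
  by rewrite (_ : 2 - 1 = 1) ?subrr ?scale0r ?add0r ?scale1r //; lra.
Qed.

End Directions.

(** * The fibre at x, and the theorem *)

Section FiberOfManifold.
Variables (R : realType) (d : nat) (M : smooth_manifold R d).

Lemma dom_chart_at (x : M) : dom (chart_at x) x.
Proof. by rewrite /chart_at; case: (cid (dom_cover x)). Qed.

Lemma chart_inv_chart_at (x : M) : chart_inv (chart_at x) (chart (chart_at x) x) = x.
Proof. by apply: chartK; exact: dom_chart_at. Qed.

(** The change from the preferred chart to itself is the identity near [y], so its jacobian is the
    identity matrix and the fibre at [x] is R^d without change of coordinates. *)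
Lemma covector_chart_at (x : M) (eta : 'cV[R]_d) : covector (chart_at x) x eta = eta.
Proof.
rewrite /covector; set i := chart_at x; set y := chart i x.
have nid : \forall z \near y, id z = (chart i \o chart_inv i) z.
  have : nbhs y (chart i @` dom i).
    apply: open_nbhs_nbhs; split; first exact: image_open.
    by exists x => //; exact: dom_chart_at.
  by apply: filterS => z [x' dx' <-] /=; rewrite chartK.
have -> : jacobian (chart i \o chart_inv i) y = 1%:M.
  apply/matrixP => j k; rewrite /jacobian /lin1_mx mxE.
  have [d1 d2] := is_diff_id y.
  by rewrite (diff_near_eq nid d1).2 d2 !mxE eqxx eq_sym.
by rewrite mul1mx.
Qed.

Lemma Tsmooth_fiber (F : forall x : M, cotangent x -> R[i]) (x : M) :
  Tsmooth F -> csmooth_on [set xi : cotangent x | xi != 0] (F x).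
Proof.
move=> /(_ (chart_at x)) [s1 s2].
set i := chart_at x in s1 s2; set y := chart i x.
set U := [set p : 'rV[R]_d * 'cV[R]_d | _ /\ _] in s1 s2.
have Uy : [set z | U (y, z)] = [set z : 'cV[R]_d | z != 0].
  apply/seteqP; split=> z [] //= z0; split => //.
  by exists x => //; exact: dom_chart_at.
have oU : open [set z | U (y, z)] by rewrite Uy; exact: open_neq0.
have Fy z : F (chart_inv i y) (covector i (chart_inv i y) z) = F x z.
  rewrite -[in RHS](covector_chart_at x z) -/i.
  by rewrite (_ : chart_inv i y = x) //; exact: chart_inv_chart_at.
have t1 := smooth_slice oU s1; have t2 := smooth_slice oU s2.
rewrite Uy in t1 t2.
by split=> k; [have := t1 k | have := t2 k];
  apply: Ck_eq; [exact: open_neq0 | move=> z _; rewrite /= Fy | exact: open_neq0 |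
    move=> z _; rewrite /= Fy].
Qed.

End FiberOfManifold.

Theorem theorem2p2 (R : realType) (d m : nat) (hd : (2 <= d)%N) (hm : (2 <= m)%N)
    (M : smooth_manifold R d)
    (M_connected : connected [set: M])
    (M_closed : closed_manifold M)
    (M_oriented : oriented_atlas M)
    (s : R) (A : principal_symbol M m s)
    (A_hermitian : forall (x : M) (xi : cotangent x), xi != 0 ->
       A x xi \is hermsymmx)
    (A_simple : forall (x : M) (xi : cotangent x), xi != 0 ->
       simple_eigenvalues (A x xi))
    (h : forall x : M, cotangent x -> R[i])
    (h_smooth : Tsmooth h)
    (h_eigenvalue : forall (x : M) (xi : cotangent x), xi != 0 ->
       eigenvalue (A x xi) (h x xi))
    (f : forall x : M, cotangent x -> projective_space R m)
    (f_eigenspace : forall (x : M) (xi : cotangent x), xi != 0 ->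
       forall v : 'cV[R[i]]_m,
         (v \in line (f x xi)) = (A x xi *m v == h x xi *: v))
    (x : M) :
  (exists v : cotangent x -> 'cV[R[i]]_m,
     (forall k : 'I_m, csmooth_on [set xi : cotangent x | xi != 0]
                         (fun xi => v xi k 0)) /\
     (forall xi : cotangent x, xi != 0 ->
        v xi != 0 /\ A x xi *m v xi = h x xi *: v xi))
  <->
  (d <> 3%N \/
   (d = 3%N /\ nullhomotopic_on R [set xi : cotangent x | xi != 0] (@f x))).
Proof.
have As j k : csmooth_on [set xi : 'cV[R]_d | xi != 0] (fun xi => A x xi j k).
  exact: (Tsmooth_fiber x (symbol_smooth A j k)).
have hs : csmooth_on [set xi : 'cV[R]_d | xi != 0] (h x).
  exact: Tsmooth_fiber.
have Ah := @symbol_homogeneous _ _ _ _ _ A x.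
have fc := fiber_proj_continuous As (A_hermitian x) hs (f_eigenspace x).
have fh := f_homogeneous Ah (A_hermitian x) hs (h_eigenvalue x) (f_eigenspace x).
split=> [[v [vs vP]]|].
  have [d3|] := pselect (d = 3%N); last by left.
  right; split => //.
  move: (f x) (f_eigenspace x) v vs vP {fc fh} => f' f'E v vs vP.
  have vP' (xi : cotangent x) : xi != 0 -> v xi != 0 /\ v xi \in line (f' xi).
    move=> xi0; have [v0 vE] := vP xi xi0; split => //.
    by rewrite f'E //; apply/eqP.
  clear -d3 hm vs vP'; rewrite /cotangent in f' v vs vP' *.
  subst d; case: m hm f' v vs vP' => [|[|m']] // _ f' v vs vP'.
  exact: section_nullhomotopic vs vP'.
(* A continuous section over the unit sphere is enough: composed with [unitize] it is homogeneous of
   degree 0, and by [f_homogeneous] it still lies in the eigenlines, so [section_smoothing]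
   applies. *)
suff : (d <> 3%N \/ d = 3%N /\ nullhomotopic_on R [set xi : cotangent x |
  xi != 0] (f x)) ->
    exists W : 'cV[R]_d -> 'cV[R[i]]_m, forall xi, `|xi| = 1 ->
      [/\ mcont W xi, W xi != 0 & cproj (f x xi) *m W xi = W xi].
  move=> hW /hW [W WP].
  apply: (section_smoothing As (A_hermitian x) hs (f_eigenspace x)
    (W := fun xi => W (unitize xi))).
  - move=> xi xi0; have [Wc _ _] := WP _ (norm_unitize xi0).
    by apply: mcont_comp Wc; exact: unitize_continuous.
  - move=> xi xi0; have [_ W0 WE] := WP _ (norm_unitize xi0).
    split; first exact: W0.
    have r0 : 0 < `|xi|^-1 by rewrite invr_gt0 normr_gt0.
    by move: WE; rewrite {1}/unitize (fh xi _ xi0 r0).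
  - by move=> r xi r0 xi0; rewrite unitizeZ.
move=> [d3|[_ f0]]; last exact: nullhomotopic_section.
move: (f x) fc fh => f' fc fh.
rewrite /cotangent in f' fc fh *; clear -hd d3 fc fh.
case: d hd d3 f' fc fh => [|[|n]] // _ d3 f' fc fh.
(* Here d = n + 2. *)
have n1 : n != 1%N by apply: contra_notN d3 => /eqP ->.
have [xi _|r xi r0 xi0|W WP] := join_section n1 fc; first exact: cproj_lproj.
  by rewrite fh.
by exists W => xi xi1; apply: WP; exact: norm1_neq0.
Qed.
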